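(* Let $\mathscr{L}$ be the lattice of flats of a matroid of rank $r \geq 2$ on a finite set $E$. Then the polynomial $\mathrm{vol}_\mathscr{L}$ is hereditary Lorentzian.
   Context: Let $K$ be the smallest flat (the set of loops) and $\underline{\mathscr{L}} = \mathscr{L}\setminus\{K,E\}$. The order complex $\Delta(\mathscr{L})$ is the simplicial complex on $\underline{\mathscr{L}}$ of all chains (totally ordered subsets) of $\underline{\mathscr{L}}$. $L(\mathscr{L}) \subseteq \mathbb{R}^{\underline{\mathscr{L}}}$ is the subspace of modular vectors: $(y_F)$ such that there are reals $c_i$, $i \in E\setminus K$, with $\sum_{i \in E\setminus K} c_i = 0$ and $y_F = \sum_{i \in F\setminus K} c_i$ for all $F$. $\mathrm{vol}_\mathscr{L} \in \mathbb{R}[t_F : F \in \underline{\mathscr{L}}]$ is the unique homogeneous polynomial of degree $r-1$ which is strongly hereditary (see below), satisfies $\Delta_{\mathrm{vol}_\mathscr{L}} = \Delta(\mathscr{L})$, $L(\mathscr{L}) \subseteq L_{\mathrm{vol}_\mathscr{L}}$, and $\partial^S \mathrm{vol}_\mathscr{L} = 1$ for every maximal chain $S$ of $\underline{\mathscr{L}}$. General definitions (for a finite index set $V$): $D_\mathbf{u} = \sum u_i\partial_i$, $\partial^S = \prod_{i\in S}\partial_i$; $L_f = \{\mathbf{v} : D_\mathbf{v} f \equiv 0\}$; $\Delta_f = \{S : \partial^S f \not\equiv 0\}$; $\tau\Delta$ is $\Delta$ with facets removed; $\mathrm{lk}_\Delta(S) = \{T : T\cap S = \varnothing, S\cup T \in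 \Delta\}$ with vertex set $V_S$. $(\Delta,L)$ is hereditary if for each $T \in \Delta$, $\ell \mapsto (\ell_i)_{i\in T}$ maps $L$ onto $\mathbb{R}^T$. $f$ is hereditary if $(\tau\Delta_f, L_f)$ is hereditary, strongly hereditary if $(\Delta_f, L_f)$ is. $f^S = \partial^S f|_{t_i=0, i\in S}$ (a polynomial in $t_j$, $j \in V_S$). For $S \in \tau\Delta_f$ choose $\ell^{(i)} \in L_f$ ($i \in S$) with $\ell^{(i)}_i = 1$, $\ell^{(i)}_j = 0$ for $j \in S\setminus\{i\}$, and set $\pi_S(\mathbf{x}) = (\mathbf{x} - \sum_{i\in S} x_i\ell^{(i)})|_{V_S}$. $\mathscr{K}_f$: if $\deg f = 1$, $\{\mathbf{v}: f(\mathbf{v})>0\}$; else $(\mathbb{R}^V_{>0} + L_f) \cap \{\mathbf{v} : \pi_{\{i\}}(\mathbf{v}) \in \mathscr{K}_{f^{\{i\}}}$ for all vertices $i$ of $\Delta_f\}$. For an open convex cone $\mathscr{K}$, a degree-$d\ge1$ homogeneous $g$ is $\mathscr{K}$-Lorentzian if for all $\mathbf{v}_1,\ldots,\mathbf{v}_d\in\mathscr{K}$, $D_{\mathbf{v}_1}\cdots D_{\mathbf{v}_d}g>0$ and (if $d\ge2$) $(\mathbf{x},\mathbf{y})\mapsto D_\mathbf{x}D_\mathbf{y}D_{\mathbf{v}_3}\cdots D_{\mathbf{v}_d}g$ has exactly one positive eigenvalue; nonnegative constants are $\mathscr{K}$-Lorentzian. A hereditary $f$ is hereditary Lorentzian if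 $f^S$ is $\mathscr{K}_{f^S}$-Lorentzian for all $S \in \tau\Delta_f$. *)

(* Defs.v *)
From mathcomp Require Import all_boot all_order all_algebra.
From mathcomp Require Import reals.
From mathcomp Require classical_sets.
From mathcomp Require Import mpoly.

Set Implicit Arguments.
Unset Strict Implicit.
Unset Printing Implicit Defensive.

Import GRing.Theory Num.Theory.
Local Open Scope ring_scope.

(* For a finite type V, R[t_i : i in V] is {mpoly R[#|V|]}; the variable t_i  *)
(* is 'X_(enum_rank i), and R^V is {ffun V -> R}.                             *)
Notation "{ 'polyOn' R , V }" := {mpoly R[#|V : finType|]}
  (at level 0, R at level 2, V at level 200,
   format "{ 'polyOn'  R ,  V }") : type_scope.

(** Simplicial complexes on V, as sets of faces *)

Definition vertices (V : finType) (Delta : {set {set V}}) : {set V} :=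
  [set i | [set i] \in Delta].

Definition facets (V : finType) (Delta : {set {set V}}) : {set {set V}} :=
  [set S | maxset (fun T => T \in Delta) S].

Definition tau (V : finType) (Delta : {set {set V}}) : {set {set V}} :=
  Delta :\: facets Delta.

Definition link (V : finType) (Delta : {set {set V}}) (S : {set V}) :
    {set {set V}} :=
  [set T : {set V} | [disjoint T & S] & S :|: T \in Delta].

Definition hereditary_pair (R : realType) (V : finType)
    (Delta : {set {set V}}) (L : {ffun V -> R} -> Prop) : Prop :=
  forall T, T \in Delta -> forall a : {ffun V -> R},
    exists l, L l /\ {in T, forall i, l i = a i}.

(** Polynomials with variables indexed by V *)

Definition pdeg (R : realType) (V : finType) (f : {polyOn R, V}) : nat :=
  (msize f).-1.

Definition peval (R : realType) (V : finType) (f : {polyOn R, V})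
    (v : {ffun V -> R}) : R :=
  f.@[fun k => v (enum_val k)].

Definition ddir (R : realType) (V : finType) (u : {ffun V -> R})
    (f : {polyOn R, V}) : {polyOn R, V} :=
  \sum_(i : V) u i *: f^`M(enum_rank i).

Definition dset (R : realType) (V : finType) (S : {set V})
    (f : {polyOn R, V}) : {polyOn R, V} :=
  f^`M[[multinom (enum_val k \in S : nat) | k < #|V|]].

Definition lineality (R : realType) (V : finType) (f : {polyOn R, V})
    (v : {ffun V -> R}) : Prop :=
  ddir v f = 0.

Definition complex_of (R : realType) (V : finType) (f : {polyOn R, V}) :
    {set {set V}} :=
  [set S | dset S f != 0].

Definition hereditary (R : realType) (V : finType) (f : {polyOn R, V}) : Prop :=
  hereditary_pair (tau (complex_of f)) (lineality f).

Definition strongly_hereditary (R : realType) (V : finType)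
    (f : {polyOn R, V}) : Prop :=
  hereditary_pair (complex_of f) (lineality f).

(* V_S, the vertex set of the link of S in the complex of f *)
Definition lkvert (R : realType) (V : finType) (f : {polyOn R, V})
    (S : {set V}) : finType :=
  {i : V | i \in vertices (link (complex_of f) S)}.

(* Besides t_i for i in S, the substitution sends to 0 the t_j with j outside *)
(* S and V_S; these do not occur in dset S f, since dset (j |: S) f = 0.      *)
Definition flink (R : realType) (V : finType) (f : {polyOn R, V})
    (S : {set V}) : {polyOn R, lkvert f S} :=
  dset S f \mPo
    [tuple if insub (enum_val k) is Some j
           then 'X_(enum_rank (j : lkvert f S)) else 0 | k < #|V|].

(* A fixed choice of the vectors l^(i), i in S; one exists when S is in       *)
(* tau (complex_of f) and f is hereditary, and two choices give projections   *)
(* that differ by an element of lineality (flink f S).                        *)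
Definition lvec (R : realType) (V : finType) (f : {polyOn R, V})
    (S : {set V}) (i : V) : {ffun V -> R} :=
  classical_sets.xget 0
    (fun l : {ffun V -> R} =>
       lineality f l /\ {in S, forall j, l j = (j == i)%:R}).

Definition proj (R : realType) (V : finType) (f : {polyOn R, V})
    (S : {set V}) (x : {ffun V -> R}) : {ffun lkvert f S -> R} :=
  [ffun j => x (val j) - \sum_(i in S) x i * lvec f S i (val j)].

(* The argument d is the degree of f: flink f [set i] has degree d.-1.        *)
Fixpoint cone_rec (R : realType) (d : nat) (V : finType) (f : {polyOn R, V})
    (v : {ffun V -> R}) {struct d} : Prop :=
  match d with
  | (_.+1 as d').+1 =>
      (exists p l : {ffun V -> R},
         [/\ forall i, 0 < p i, lineality f l & v = p + l])
      /\ (forall i, i \in vertices (complex_of f) ->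
            cone_rec d' (flink f [set i]) (proj f [set i] v))
  | _ => 0 < peval f v
  end.

Definition cone (R : realType) (V : finType) (f : {polyOn R, V}) :
    {ffun V -> R} -> Prop :=
  cone_rec (pdeg f) f.

(* Gram matrix of a bilinear form on R^V in the standard basis *)
Definition gram (R : realType) (V : finType)
    (B : {ffun V -> R} -> {ffun V -> R} -> R) : 'M[R]_#|V| :=
  \matrix_(k, m) B [ffun i => (i == enum_val k)%:R]
                   [ffun i => (i == enum_val m)%:R].

(* s lists the eigenvalues with multiplicity *)
Definition one_positive_eigenvalue (R : realType) (n : nat) (A : 'M[R]_n) :
    Prop :=
  exists2 s : seq R, char_poly A = \prod_(a <- s) ('X - a%:P)
                   & count (fun a => 0 < a) s = 1%N.

(* D_(v_1) ... D_(v_d) g is a constant when g is homogeneous of degree d, and *)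
(* it is read off as the coefficient at the monomial 1.                       *)
Definition Lorentzian_on (R : realType) (V : finType)
    (K : {ffun V -> R} -> Prop) (g : {polyOn R, V}) : Prop :=
  let d := pdeg g in
  [/\ g \is d.-homog,
      d = 0%N -> 0 <= g@_0%MM
    & (0 < d)%N ->
      forall v : d.-tuple {ffun V -> R}, (forall k, K (tnth v k)) ->
        0 < (foldr (@ddir R V) g v)@_0%MM
        /\ ((2 <= d)%N ->
            one_positive_eigenvalue
              (gram (fun x y =>
                 (ddir x (ddir y (foldr (@ddir R V) g (drop 2 v))))@_0%MM)))].

Definition hereditary_Lorentzian (R : realType) (V : finType)
    (f : {polyOn R, V}) : Prop :=
  hereditary f /\
  forall S, S \in tau (complex_of f) ->
    Lorentzian_on (cone (flink f S)) (flink f S).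

(** Matroids and their lattices of flats *)

Record matroid (E : finType) := Matroid {
  indep : {set {set E}};
  indep_set0 : set0 \in indep;
  indep_sub : forall I J : {set E}, J \in indep -> I \subset J -> I \in indep;
  indep_aug : forall I J : {set E}, I \in indep -> J \in indep ->
    (#|I| < #|J|)%N -> exists2 e, e \in J :\: I & e |: I \in indep
}.

Definition mrank (E : finType) (M : matroid E) (A : {set E}) : nat :=
  \max_(I in indep M | I \subset A) #|I|.

Definition flat (E : finType) (M : matroid E) (F : {set E}) : bool :=
  [forall e, (e \notin F) ==> (mrank M F < mrank M (e |: F))%N].

Definition loops (E : finType) (M : matroid E) : {set E} :=
  [set e | [set e] \notin indep M].

Definition proper_flat (E : finType) (M : matroid E) : finType :=
  {F : {set E} | [&& flat M F, F != loops M & F != [set: E]]}.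

Definition order_complex (E : finType) (M : matroid E) :
    {set {set proper_flat M}} :=
  [set S : {set proper_flat M} | [forall F in S, forall G in S,
     (val F \subset val G) || (val G \subset val F)]].

Definition modular_vector (R : realType) (E : finType) (M : matroid E)
    (y : {ffun proper_flat M -> R}) : Prop :=
  exists c : E -> R,
    \sum_(i in ~: loops M) c i = 0
    /\ forall F, y F = \sum_(i in val F :\: loops M) c i.

Definition is_vol (R : realType) (E : finType) (M : matroid E)
    (f : {polyOn R, proper_flat M}) : Prop :=
  [/\ f \is (mrank M [set: E]).-1.-homog,
      strongly_hereditary f,
      complex_of f = order_complex M,
      forall y, modular_vector y -> lineality f y
    & forall S, S \in facets (order_complex M) -> dset S f = 1].

(* Main.v *)
(* A polynomial f with lineality space L is determined by its restrictions to the
   links of the vertices of its complex: since f is invariant along L, the partial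
   derivative of f at a vertex i is the pullback of the link polynomial f^i under
   the projection pi_i. Existence of vol is proved by integrating these prescribed
   derivatives by decreasing size of the face. That the primitives are again
   invariant along L reduces to the case of degree one, which is the balancing
   condition: the flats covering A inside a flat C of rank rk A + 2 partition C \ A.

   The Lorentzian property is proved by induction on the degree. Write
   v_3 = p + l with p > 0 and l in L, and let A be the Hessian of
   D_(v_3) ... D_(v_d) f, so that A = sum_i p_i B_i, where B_i is the pullback of
   the Hessian of D_(v_4) ... D_(v_d) f^i. The reverse Cauchy-Schwarz inequalities
   for the B_i give <x, T x> <= <T x, T x>, where T = D^-1 A for a positive diagonal
   matrix D with T p = p, and T is self-adjoint for the inner product of D. Hence
   the eigenvalues of T are <= 0 or >= 1, and Perron-Frobenius, which applies because
   the links are connected, shows that 1 is the largest eigenvalue and is simple.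
   In degree two, the quadrics of vol are nonpositive on a hyperplane: modulo modular
   vectors, a vector of that hyperplane is supported on pairwise nonadjacent vertices
   of the link. *)

From HB Require Import structures.
From mathcomp Require Import all_boot all_order all_algebra.
From mathcomp Require Import reals complex ring lra zify.
From mathcomp Require boolp classical_sets.
From mathcomp Require Import mpoly.
Require Import Defs.

Set Implicit Arguments.
Unset Strict Implicit.
Unset Printing Implicit Defensive.

Import Order.TTheory GRing.Theory Num.Theory.
Local Open Scope ring_scope.

(** * Bilinear forms *)

Section LinearAlgebra.
Variables (R : realFieldType) (V : finType).
Implicit Types (a : V -> V -> R) (x y v : V -> R).

Definition bform a x y : R := \sum_i \sum_j a i j * (x i * y j).

Lemma bformE a x y : bform a x y = \sum_i x i * \sum_j a i j * y j.
Proof.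
by apply: eq_bigr => i _; rewrite mulr_sumr; apply: eq_bigr => j _; ring.
Qed.

Lemma bformC a x y : (forall i j, a i j = a j i) -> bform a x y = bform a y x.
Proof.
move=> aC; rewrite /bform exchange_big; apply: eq_bigr => i _.
by apply: eq_bigr => j _; rewrite aC (mulrC (x j)).
Qed.

Lemma bform_comb a s t x y z :
  bform a (fun i => s * x i + t * y i) z = s * bform a x z + t * bform a y z.
Proof.
rewrite /bform !mulr_sumr -big_split; apply: eq_bigr => i _.
by rewrite !mulr_sumr -big_split; apply: eq_bigr => j _ /=; ring.
Qed.

Lemma bform_combr a s t x y z :
  bform a z (fun i => s * x i + t * y i) = s * bform a z x + t * bform a z y.
Proof.
rewrite /bform !mulr_sumr -big_split; apply: eq_bigr => i _.
by rewrite !mulr_sumr -big_split; apply: eq_bigr => j _ /=; ring.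
Qed.

Lemma eq_bform a x x' y y' : x =1 x' -> y =1 y' -> bform a x y = bform a x' y'.
Proof.
by move=> xx' yy'; apply: eq_bigr => i _; apply: eq_bigr => j _; rewrite xx' yy'.
Qed.

(** When the form is symmetric and positive at [v], this is the signature condition of exactly one
    positive eigenvalue, stated without eigenvalues. *)
Definition neg_orth a v := forall x, bform a x v = 0 -> bform a x x <= 0.

(** For [x] orthogonal to [v], the vector [lv * x - lx * v] lies on the hyperplane and has value
    lv^2 q(x) + lx^2 q(v), with q the quadratic form. Positivity of q(v) keeps [v] off the
    hyperplane, so [lv] is nonzero. *)
Lemma neg_orth_hyperplane a (c : V -> R) v :
    (forall i j, a i j = a j i) ->
    (forall x, \sum_i c i * x i = 0 -> bform a x x <= 0) ->
  0 < bform a v v -> neg_orth a v.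
Proof.
move=> aC ac av x xv.
set lx := \sum_i c i * x i; set lv := \sum_i c i * v i.
have /ac : \sum_i c i * (lv * x i + - lx * v i) = 0.
  rewrite (eq_bigr (fun i => lv * (c i * x i) + - lx * (c i * v i))); last first.
    by move=> i _; ring.
  by rewrite big_split /= -!mulr_sumr -/lx -/lv; ring.
have lv0 : lv != 0 by apply: contraTneq av => /ac; rewrite leNgt.
rewrite bform_comb !bform_combr (bformC v x aC) xv => h.
have lv2 : 0 < lv ^+ 2 by rewrite exprn_even_gt0.
have : lv ^+ 2 * bform a x x <= 0.
  by have := mulr_ge0 (sqr_ge0 lx) (ltW av); lra.
by rewrite pmulr_rle0.
Qed.

(** The orthogonal of [v] is itself a hyperplane on which the form is nonpositive, so any other
    positive vector may replace [v]. *)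
Lemma neg_orth_change a v w : (forall i j, a i j = a j i) ->
  neg_orth a v -> 0 < bform a w w -> neg_orth a w.
Proof.
move=> aC av; apply: (@neg_orth_hyperplane a (fun i => \sum_j a i j * v j)) => //.
move=> x xv; apply: av; rewrite bformE -[RHS]xv.
by apply: eq_bigr => i _; rewrite mulrC.
Qed.

(** Nonpositivity is applied to the component of [x] orthogonal to [v], with the denominator
    cleared. *)
Lemma reverse_CS a v : (forall i j, a i j = a j i) ->
    0 < bform a v v -> neg_orth a v ->
  forall x, bform a x x * bform a v v <= bform a x v ^+ 2.
Proof.
move=> aC av neg x.
have := neg (fun i => bform a v v * x i + - bform a x v * v i).
rewrite !bform_comb !bform_combr (bformC v x aC) => /(_ ltac:(ring)) h.
have : bform a v v * (bform a x x * bform a v v - bform a x v ^+ 2) <= 0 by lra.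
by rewrite pmulr_rle0 // subr_le0.
Qed.

Lemma psd_CS a x y : (forall i j, a i j = a j i) ->
    (forall z, 0 <= bform a z z) ->
  bform a x y ^+ 2 <= bform a x x * bform a y y.
Proof.
move=> aC psd.
have [y0|yN0] := eqVneq (bform a y y) 0; last first.
  have := psd (fun i => bform a y y * x i + - bform a x y * y i).
  rewrite !bform_comb !bform_combr (bformC y x aC) => h.
  have ypos : 0 < bform a y y by rewrite lt_def yN0 psd.
  have : 0 <= bform a y y * (bform a x x * bform a y y - bform a x y ^+ 2) by lra.
  by rewrite pmulr_rge0 // subr_ge0.
(* With [y] isotropic, b = a(x,y) and q = a(x,x), this vector has value -b^2 (q + 2), which forces b
   = 0; the summand 1 covers the case q = 0. *)
have := psd (fun i => bform a x y * x i + - (bform a x x + 1) * y i).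
rewrite !bform_comb !bform_combr (bformC y x aC) y0 => h.
have := psd x; have := sqr_ge0 (bform a x y); nra.
Qed.

(** The columns of the cokernel lie in the kernel of [a], so [b] is killed by the cokernel and
    belongs to the row space; symmetry turns the row combination into a solution. *)
Lemma fredholm a (b : V -> R) : (forall i j, a i j = a j i) ->
    (forall c, (forall i, \sum_j a i j * c j = 0) -> \sum_i b i * c i = 0) ->
  exists y, forall i, \sum_j a i j * y j = b i.
Proof.
move=> aC orth.
pose A : 'M[R]_#|V| := \matrix_(k, m) a (enum_val k) (enum_val m).
pose u : 'rV[R]_#|V| := \row_k b (enum_val k).
have sumV (F : V -> R) : \sum_i F i = \sum_(k < #|V|) F (enum_val k).
  by rewrite (reindex _ (onW_bij _ (enum_val_bij V))).
have /submxP[w wA] : (u <= A)%MS.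
  rewrite submxE; apply/eqP/rowP => k; rewrite !mxE.
  have h i : \sum_j a i j * cokermx A (enum_rank j) k = 0.
    have /matrixP/(_ (enum_rank i) k) := mulmx_coker A; rewrite !mxE => hk.
    rewrite -[RHS]hk (sumV (fun j => a i j * cokermx A (enum_rank j) k)).
    by apply: eq_bigr => m _; rewrite [A _ _]mxE enum_valK enum_rankK.
  have hb := orth _ h; rewrite -[RHS]hb.
  rewrite (sumV (fun i => b i * cokermx A (enum_rank i) k)).
  by apply: eq_bigr => i _; rewrite [u _ _]mxE enum_valK.
exists (fun i => w 0 (enum_rank i)) => i.
have /rowP/(_ (enum_rank i)) := wA; rewrite !mxE enum_rankK => ->.
rewrite (sumV (fun j => a i j * w 0 (enum_rank j))); apply: eq_bigr => m _.
by rewrite [A _ _]mxE enum_rankK enum_valK mulrC aC.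
Qed.

(* The Laplacian of the weighted graph [a i j * p i * p j]. *)
Lemma perron_laplacian a p x : (forall i j, a i j = a j i) ->
    (forall i, 0 < p i) ->
  2 * (\sum_i (\sum_j a i j * p j) / p i * x i ^+ 2 - bform a x x) =
  \sum_i \sum_j a i j * (p i * p j) * (x i / p i - x j / p j) ^+ 2.
Proof.
move=> aC p_gt0.
pose F i j := a i j * (p j / p i * x i ^+ 2).
have F1 : \sum_i (\sum_j a i j * p j) / p i * x i ^+ 2 = \sum_i \sum_j F i j.
  apply: eq_bigr => i _; rewrite !mulr_suml; apply: eq_bigr => j _.
  by rewrite /F; ring.
have F2 : \sum_i \sum_j F i j = \sum_i \sum_j F j i by rewrite exchange_big.
transitivity (\sum_i \sum_j (F i j + F j i - 2 * (a i j * (x i * x j)))).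
  rewrite F1 mulrBr mulr2n mulrDl mul1r {2}F2 /bform mulr_sumr -big_split -sumrB.
  apply: eq_bigr => i _; rewrite mulr_sumr -big_split -sumrB /=.
  by apply: eq_bigr => j _; ring.
apply: eq_bigr => i _; apply: eq_bigr => j _; rewrite /F (aC j i); field.
by rewrite !gt_eqF.
Qed.

(* With [D = diag (q i / p i)], the operator [D^-1 a] fixes [p], and the       *)
(* hypotheses say that its spectrum avoids the open interval ]0, 1[ and, by   *)
(* Perron-Frobenius, that 1 is its largest eigenvalue and is simple. The      *)
(* proof inverts the operator [D - a] on the orthogonal of [p].               *)
Lemma trickle_down a (p : V -> R) (q := fun i => \sum_j a i j * p j) :
    (forall i j, a i j = a j i) ->
    (forall i, 0 < p i) -> (forall i, 0 < q i) ->
    (forall i j, i != j -> 0 <= a i j) ->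
    (forall phi : V -> R, (forall i j, i != j -> 0 < a i j -> phi i = phi j) ->
       forall i j, phi i = phi j) ->
    (forall x, bform a x x <= \sum_i p i / q i * (\sum_j a i j * x j) ^+ 2) ->
  neg_orth a p.
Proof.
move=> aC p_gt0 q_gt0 a_ge0 conn bochner x xp.
have pN0 i : p i != 0 by rewrite gt_eqF.
have qN0 i : q i != 0 by rewrite gt_eqF.
pose D i := q i / p i.
pose n i j := (i == j)%:R * D i - a i j.
have nC i j : n i j = n j i.
  by rewrite /n aC eq_sym; case: eqP => [->|]; rewrite ?mul0r.
have nE i y : \sum_j n i j * y j = D i * y i - \sum_j a i j * y j.
  rewrite /n (eq_bigr _ (fun j _ => mulrBl _ _ _)) sumrB; congr (_ - _).
  rewrite (bigD1 i) //= big1 ?addr0 ?eqxx ?mul1r // => j.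
  by rewrite eq_sym => /negPf ->; rewrite !mul0r.
have nbE y z : bform n y z = \sum_i D i * (y i * z i) - bform a y z.
  rewrite !bformE -sumrB; apply: eq_bigr => i _; rewrite nE; ring.
have nlap y : 2 * bform n y y =
    \sum_i \sum_j a i j * (p i * p j) * (y i / p i - y j / p j) ^+ 2.
  by rewrite -perron_laplacian // nbE; congr (_ * (_ - _)).
have t_ge0 y i j : 0 <= a i j * (p i * p j) * (y i / p i - y j / p j) ^+ 2.
  have [->|ij] := eqVneq i j; first by rewrite subrr expr0n mulr0.
  by rewrite mulr_ge0 ?sqr_ge0 // mulr_ge0 ?a_ge0 // mulr_ge0 // ltW.
have npsd y : 0 <= bform n y y.
  have : 0 <= 2 * bform n y y.
    by rewrite nlap; apply: sumr_ge0 => i _; apply: sumr_ge0.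
  by rewrite pmulr_rge0.
(* Solves [n y = D x]. By the Laplacian identity and connectedness the kernel of [n] consists of
   multiples of [p], and [D x] pairs with [p] to a(x,p) = 0. *)
have [c nc|y ny] := @fredholm n (fun i => D i * x i) nC.
  have c0 : bform n c c = 0.
    by rewrite bformE big1 // => i _; rewrite nc mulr0.
  have prop : forall i j, c i / p i = c j / p j.
    apply: conn => i j ij aij; move: (nlap c); rewrite c0 mulr0 => /esym/eqP.
    rewrite psumr_eq0; last by move=> k _; apply: sumr_ge0.
    move/allP/(_ i (mem_index_enum _)) => /=.
    rewrite psumr_eq0 // => /allP/(_ j (mem_index_enum _)) /=.
    rewrite mulf_eq0 expf_eq0 /= subr_eq0 => /orP[|/eqP //].
    by rewrite !mulf_eq0 !gt_eqF.
  have [t ct] : exists t, forall i, c i = t * p i.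
    case: (pickP (@predT V)) => [i0 _|V0]; last by exists 0 => i; have := V0 i.
    by exists (c i0 / p i0) => i; rewrite (prop i0 i) divfK.
  rewrite -[RHS](mulr0 t) -[in RHS]xp bformE mulr_sumr; apply: eq_bigr => i _.
  rewrite -/(q i) ct /D; field; exact: pN0.
have nxy z : bform n z y = \sum_i D i * (x i * z i).
  by rewrite bformE; apply: eq_bigr => i _; rewrite ny; ring.
pose s z w := \sum_i D i * (z i * w i).
(* Since [a y = D (y - x)], the hypothesis at [y] expands into inner products for [D], and the terms
   s(y,y) cancel. *)
have Eyy : bform n y y <= s x x.
  have := bochner y.
  have -> : bform a y y = s y y - bform n y y by rewrite nbE /s; ring.
  suff -> : \sum_i p i / q i * (\sum_j a i j * y j) ^+ 2
      = s y y - 2 * bform n y y + s x x by lra.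
  rewrite nxy /s mulr_sumr -sumrB -big_split; apply: eq_bigr => i _ /=.
  have -> : \sum_j a i j * y j = D i * (y i - x i).
    by have := ny i; rewrite nE => h; rewrite mulrBr -h; ring.
  rewrite /D; field; by rewrite pN0 qN0.
have sxx : 0 <= s x x.
  apply: sumr_ge0 => i _; rewrite -expr2 mulr_ge0 ?sqr_ge0 //.
  by rewrite divr_ge0 // ltW.
(* As n(x,y) = s(x,x), Cauchy-Schwarz and [Eyy] give s(x,x) <= n(x,x) = s(x,x) - a(x,x) when s(x,x)
   is positive. *)
have cs := psd_CS x y nC npsd.
have {}cs : s x x ^+ 2 <= bform n x x * s x x.
  have sE : bform n x y = s x x by rewrite nxy.
  rewrite -[in leLHS]sE; apply: le_trans cs _.
  exact: ler_wpM2l.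
have nxx : bform n x x = s x x - bform a x x by rewrite nbE.
have [sx0|sx0] := eqVneq (s x x) 0.
  by have := npsd x; rewrite nxx sx0; lra.
have sx : 0 < s x x by rewrite lt_def sx0.
by move: cs; rewrite expr2 ler_pM2r // nxx; lra.
Qed.

End LinearAlgebra.

(** * Signature of real symmetric matrices *)

Lemma char_poly_conj (F : comUnitRingType) n (P A : 'M[F]_n) : P \in unitmx ->
  char_poly (invmx P *m A *m P) = char_poly A.
Proof.
move=> Pu; pose c := map_mx (@polyC F).
have cP : c _ _ (invmx P) *m c _ _ P = 1%:M by rewrite -map_mxM mulVmx // map_mx1.
rewrite /char_poly /char_poly_mx.
have -> : 'X%:M - c n n (invmx P *m A *m P)
    = c _ _ (invmx P) *m ('X%:M - c _ _ A) *m c _ _ P.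
  rewrite mulmxBr mulmxBl scalar_mxC -[_%:M *m _ *m _]mulmxA cP mulmx1.
  by rewrite /c !map_mxM.
by rewrite !det_mulmx mulrAC -det_mulmx cP det1 mul1r.
Qed.

Section Signature.
(* [C] abstracts the field R[i], whose concrete structure computes too eagerly *)
Variables (R : realFieldType) (C : numClosedFieldType) (iota : {rmorphism R -> C}).
Hypothesis iota_real : forall x, iota x \is Num.real.
Hypothesis real_iota : forall z, z \is Num.real -> exists x, z = iota x.
Hypothesis iota_le : {mono iota : x y / x <= y}.
Variables (n : nat) (A : 'M[R]_n).
Hypothesis AT : A^T = A.

Local Notation phi := (map_mx iota).
Local Notation adj M := (map_mx Num.conj (trmx M)).

Definition mxform (x y : 'rV[R]_n) : R := (x *m A *m y^T) 0 0.

Lemma mxformC x y : mxform x y = mxform y x.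
Proof.
rewrite /mxform -[RHS]trace_mx11 -mxtrace_tr -[LHS]trace_mx11.
by rewrite !trmx_mul trmxK AT mulmxA.
Qed.

Let iota_lt : {mono iota : x y / x < y}.
Proof. exact: leW_mono iota_le. Qed.

Let adj_phi m k (M : 'M[R]_(m, k)) : adj (phi M) = phi M^T.
Proof. by apply/matrixP=> i j; rewrite !mxE; apply/CrealP. Qed.

Let hermA : phi A \is hermitianmx n false Num.conj.
Proof.
apply: realsym_hermsym; last by apply/mxOverP => i j; rewrite mxE.
apply/is_hermitianmxP; rewrite expr0 scale1r map_mx_id //.
by rewrite -{1}AT -map_trmx.
Qed.

Let phi_pair (u w : 'rV[R]_n) :
  (phi u *m phi A *m phi w^T) 0 0 = iota (mxform u w).
Proof. by rewrite -!map_mxM mxE. Qed.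

(** The mixed terms cancel by symmetry of [A], so a complex vector can be tested through its real
    and imaginary parts. *)
Let hermform_real (x y : 'rV[R]_n) :
  ((phi x + 'i *: phi y) *m phi A *m adj (phi x + 'i *: phi y)) 0 0 =
  iota (mxform x x + mxform y y).
Proof.
have -> : adj (phi x + 'i *: phi y) = phi x^T - 'i *: phi y^T.
  apply/matrixP => i j; rewrite !mxE rmorphD rmorphM /= conjCi mulNr.
  by congr (_ - _ * _); apply/CrealP.
have eD (M N : 'M[C]_1) : (M + N) 0 0 = M 0 0 + N 0 0 by rewrite mxE.
have eB (M N : 'M[C]_1) : (M - N) 0 0 = M 0 0 - N 0 0 by rewrite !mxE.
have eZ z (M : 'M[C]_1) : (z *: M) 0 0 = z * M 0 0 by rewrite mxE.
rewrite !mulmxDl !mulmxBr -!scalemxAl -!scalemxAr scalerA.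
rewrite eD !eB !eZ !phi_pair (mxformC y x) -expr2 sqrCi rmorphD; ring.
Qed.

Let hermform_spectral (c : 'rV[C]_n) :
  let U := spectralmx (phi A) in
  (c *m U *m phi A *m adj (c *m U)) 0 0 =
  \sum_i spectral_diag (phi A) 0 i * `|c 0 i| ^+ 2.
Proof.
move=> U; have /hermitian_normalmx/orthomx_spectralP def_A := hermA.
have Uu : U \is unitarymx := spectral_unitarymx _.
have UU : U *m adj U = 1%:M by apply/unitarymxP.
have UA : U *m phi A = diag_mx (spectral_diag (phi A)) *m U.
  by rewrite [in LHS]def_A -/U !mulmxA mulmxV ?spectral_unit // mul1mx.
rewrite -[c *m U *m _]mulmxA UA trmx_mul map_mxM !mulmxA.
rewrite -[_ *m U *m _]mulmxA UU mulmx1.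
rewrite mxE; apply: eq_bigr => i _; rewrite mul_mx_diag !mxE normCK; ring.
Qed.

(** The spectral theorem over [C] gives real eigenvalues. Two positive ones would produce a vector
    orthogonal to [v] with positive Hermitian value, against nonpositivity on its real and imaginary
    parts; with none, the form would be nonpositive at [v]. *)
Lemma one_positive_of_neg_orth (v : 'rV[R]_n) :
    0 < mxform v v -> (forall x, mxform x v = 0 -> mxform x x <= 0) ->
  exists2 s : seq R, char_poly A = \prod_(a <- s) ('X - a%:P)
                   & count (fun a => 0 < a) s = 1%N.
Proof.
move=> v_gt0 neg; pose U := spectralmx (phi A).
have Uu : U \is unitarymx := spectral_unitarymx _.
have UU : adj U *m U = 1%:M.
  by rewrite -invmx_unitary // mulVmx // spectral_unit.
have /mxOverP Dreal := hermitian_spectral_diag_real hermA.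
have [d dE] := fin_all_exists (fun i => real_iota (Dreal 0 i)).
have d_gt0 i : (0 < spectral_diag (phi A) 0 i) = (0 < d i).
  by rewrite dE -(rmorph0 iota) iota_lt.
exists [seq d i | i <- enum 'I_n].
  apply: (map_poly_inj iota); rewrite map_char_poly.
  have /hermitian_normalmx/orthomx_spectralP -> := hermA.
  rewrite char_poly_conj ?spectral_unit // char_poly_trig; last first.
    by apply/is_trig_mxP => i j ij; rewrite mxE -val_eqE /= ltn_eqF.
  rewrite big_map big_enum map_prod_XsubC /=; apply: eq_bigr => i _.
  by rewrite mxE eqxx mulr1n dE.
have le1 i j : i != j -> 0 < d i -> 0 < d j -> False.
  rewrite -!d_gt0 => ij Di Dj.
  pose av k := (row k U *m phi A *m phi v^T) 0 0.
  (* Eigenbasis coordinates of a nonzero vector orthogonal to [v] in the plane of eigenvectors [i]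
     and [j]; eigenvector [j] is taken alone when it is already orthogonal, since the general
     formula could then give 0. *)
  pose c : 'rV[C]_n := if av j == 0 then delta_mx 0 j else
    av j *: delta_mx 0 i - av i *: delta_mx 0 j.
  have cv : (c *m U *m phi A *m phi v^T) 0 0 = 0.
    rewrite /c; case: eqP => [avj|_]; first by rewrite -rowE.
    rewrite !mulmxBl -!scalemxAl -!rowE [LHS]mxE [X in _ + X]mxE.
    by rewrite [X in X + _]mxE [X in - X]mxE -/(av i) -/(av j) mulrC subrr.
  have cpos : 0 < (c *m U *m phi A *m adj (c *m U)) 0 0.
    rewrite hermform_spectral (bigD1 i) // (bigD1 j) 1?eq_sym //=.
    rewrite big1 ?addr0; last first.
      move=> k /andP[ki kj]; rewrite /c; case: ifP => _; rewrite !mxE eqxx /=.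
        by rewrite (negPf kj) normr0 expr0n mulr0.
      by rewrite (negPf ki) (negPf kj) !mulr0 subrr normr0 expr0n mulr0.
    rewrite /c; case: ifP => [_|avj]; rewrite !mxE !eqxx /=.
      by rewrite (negPf ij) normr0 expr0n mulr0 add0r normr1 expr1n mulr1.
    rewrite (negPf ij) (eq_sym j) (negPf ij) !mulr0 !mulr1 subr0 sub0r normrN.
    apply: ltr_pwDl; last by rewrite mulr_ge0 ?exprn_ge0 // ltW.
    by rewrite mulr_gt0 // exprn_gt0 // normr_gt0 avj.
  move: (c *m U) cv cpos => w cv cpos.
  have [a aE] := fin_all_exists (fun k => real_iota (Creal_Re (w 0 k))).
  have [b bE] := fin_all_exists (fun k => real_iota (Creal_Im (w 0 k))).
  have wE : w = phi (\row_k a k) + 'i *: phi (\row_k b k).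
    by apply/rowP => k; rewrite !mxE -aE -bE -Crect.
  move: cpos; rewrite wE hermform_real -(rmorph0 iota) iota_lt ltNge.
  move=> /negP; apply.
  move: cv; rewrite wE !mulmxDl -!scalemxAl mxE [X in _ + X]mxE !phi_pair.
  move=> cv; have av0 : 'Re (iota (mxform (\row_k a k) v) +
      'i * iota (mxform (\row_k b k) v)) = 0 by rewrite cv raddf0.
  have bv0 : 'Im (iota (mxform (\row_k a k) v) +
      'i * iota (mxform (\row_k b k) v)) = 0 by rewrite cv raddf0.
  move: av0 bv0; rewrite Re_rect ?Im_rect // => av0 bv0.
  have {}av0 : mxform (\row_k a k) v = 0 by apply/(fmorph_inj iota); rewrite rmorph0.
  have {}bv0 : mxform (\row_k b k) v = 0 by apply/(fmorph_inj iota); rewrite rmorph0.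
  by rewrite -[0]addr0 lerD ?neg.
have [i Di] : exists i, 0 < d i.
  apply/existsP; apply: contraTT v_gt0 => /existsPn Dle.
  have := hermform_spectral (phi v *m adj U);
    rewrite /= -/U -[phi v *m _ *m U]mulmxA UU mulmx1.
  rewrite adj_phi phi_pair => vE.
  rewrite -leNgt -iota_le vE rmorph0; apply: sumr_le0 => k _.
  by rewrite mulr_le0_ge0 ?exprn_ge0 // dE -(rmorph0 iota) iota_le leNgt.
rewrite count_map -size_filter; apply/eqP; rewrite eqn_leq; apply/andP; split.
  rewrite leqNgt; apply/negP => big.
  have : uniq [seq i <- enum 'I_n | 0 < d i] by rewrite filter_uniq ?enum_uniq.
  have : {in [seq i <- enum 'I_n | 0 < d i], forall i, 0 < d i}.
    by move=> k; rewrite mem_filter => /andP[].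
  move: big; case: [seq _ <- _ | _] => [|k [|l s]] //= _ sD /andP[].
  rewrite inE negb_or => /andP[kl _] _.
  by apply: (le1 k l kl); apply: sD; rewrite !inE eqxx ?orbT.
by rewrite size_filter -has_count; apply/hasP; exists i; rewrite ?mem_enum.
Qed.

End Signature.

Lemma one_positive_eigenvalueP (R : realType) n (A : 'M[R]_n) (v : 'rV[R]_n) :
    A^T = A -> 0 < mxform A v v ->
    (forall x, mxform A x v = 0 -> mxform A x x <= 0) ->
  one_positive_eigenvalue A.
Proof.
move=> AT v_gt0 neg.
apply: (@one_positive_of_neg_orth R R[i] (real_complex R) _ _ _ n A AT v)
  => // [x|z|x y]; last exact: lecR.
- by apply/complex_realP; exists x.
- by move/complex_realP.
Qed.

(** * Derivatives of polynomials *)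

Local Notation "''d_' i f" := (mderiv (enum_rank i) f)
  (at level 10, i at level 8, f at level 9, format "''d_' i  f").

Section Derivatives.
Variables (R : realType) (V : finType).
Implicit Types (f g h : {polyOn R, V}) (u w : {ffun V -> R}) (S T : {set V}).

Definition basis_vec (i : V) : {ffun V -> R} := [ffun j => (j == i)%:R].

Lemma mderivC_comm i j f : 'd_i ('d_j f) = 'd_j ('d_i f).
Proof. exact: mderiv_comm. Qed.

Lemma ddir_is_linear u : linear (@ddir R V u).
Proof.
move=> a f g; rewrite /ddir scaler_sumr -big_split; apply: eq_bigr => i _ /=.
by rewrite mderivD mderivZ scalerDr !scalerA mulrC.
Qed.

HB.instance Definition _ u :=
  GRing.isLinear.Build R {polyOn R, V} {polyOn R, V} _ (ddir u)
    (ddir_is_linear u).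

Lemma ddir_basis i f : ddir (basis_vec i) f = 'd_i f.
Proof.
rewrite /ddir (bigD1 i) //= big1 ?addr0 ?ffunE ?eqxx ?scale1r // => j ji.
by rewrite ffunE (negPf ji) scale0r.
Qed.

Lemma ddirDl u w f : ddir (u + w) f = ddir u f + ddir w f.
Proof.
by rewrite /ddir -big_split; apply: eq_bigr => i _; rewrite ffunE scalerDl.
Qed.

Lemma mderiv_ddir i u f : 'd_i (ddir u f) = ddir u ('d_i f).
Proof.
rewrite /ddir raddf_sum; apply: eq_bigr => j _ /=.
by rewrite mderivZ mderivC_comm.
Qed.

Lemma ddirC u w f : ddir u (ddir w f) = ddir w (ddir u f).
Proof.
rewrite [ddir u f]/ddir [LHS]/ddir linear_sum; apply: eq_bigr => i _ /=.
by rewrite linearZ /= mderiv_ddir.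
Qed.

Lemma mderiv_homog i d f : f \is d.-homog -> 'd_i f \is d.-1.-homog.
Proof.
move=> fd; apply/dhomogP => m; rewrite mcoeff_msupp mcoeff_deriv => mN0.
have : f@_(m + U_(enum_rank i)) != 0 by apply: contraNneq mN0 => ->; rewrite mul0rn.
by rewrite -mcoeff_msupp => /(dhomog_mf fd) <-; rewrite /= mdegD mdeg1 addn1.
Qed.

Lemma homog0_const f : f \is 0.-homog -> f = f@_0%MM *: 1.
Proof.
move=> f0; apply/mpolyP => m; rewrite mcoeffZ mcoeff1.
have [->|mN0] := eqVneq m 0%MM; first by rewrite mulr1.
by rewrite mulr0 (dhomog_nemf_coeff f0) //= mdeg_eq0.
Qed.

Lemma mderiv_homog0 i f : f \is 0.-homog -> 'd_i f = 0.
Proof.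
by move=> /homog0_const ->; rewrite mderivZ -mpolyC1 mderivC scaler0.
Qed.

Lemma mnm_index (m : 'X_{1..#|V|}) k : (0 < m k)%N -> exists2 m', m = (m' + U_(k))%MM
  & m' k = (m k).-1.
Proof.
move=> mk; exists (m - U_(k))%MM.
  by rewrite submK // lep1mP -lt0n.
by rewrite mnmBE mnm1E eqxx subn1.
Qed.

(** In characteristic zero and positive degree, every monomial contains a variable and survives
    differentiation by it. *)
Lemma eq0_of_mderiv d f : f \is d.+1.-homog -> (forall i, 'd_i f = 0) -> f = 0.
Proof.
move=> fd f'0; apply/mpolyP => m; rewrite mcoeff0; apply/eqP; apply: contraT => fm.
have mdm : mdeg m = d.+1 by rewrite (dhomog_mf fd) // mcoeff_msupp.
have [k mk] : exists k, (0 < m k)%N.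
  apply/existsP; apply: contraT => /existsPn m0.
  suff : mdeg m = 0%N by rewrite mdm.
  apply/eqP; rewrite mdeg_eq0; apply/eqP/mnmP => k; rewrite mnm0E.
  by apply/eqP; have := m0 k; rewrite lt0n negbK.
have [m' mE m'k] := mnm_index mk.
have := congr1 (mcoeff m') (f'0 (enum_val k)).
rewrite enum_valK mcoeff_deriv mcoeff0 -mE => /eqP.
by rewrite -mulr_natr mulf_eq0 pnatr_eq0 orbF (negPf fm).
Qed.

Lemma euler d f : f \is d.-homog -> \sum_i 'X_(enum_rank i) * 'd_i f = d%:R *: f.
Proof.
move=> fd; apply/mpolyP => m; rewrite raddf_sum mcoeffZ /=.
have coefXd (i : V) : ('X_(enum_rank i) * 'd_i f)@_m = (m (enum_rank i))%:R * f@_m.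
  have [mi0|mi] := posnP (m (enum_rank i)); last first.
    have [m' mE m'i] := mnm_index mi.
    have := mcoeffMX ('d_i f) U_(enum_rank i) m'.
    rewrite addmC -mE mulrC => ->; rewrite mcoeff_deriv -mE m'i prednK //.
    by rewrite mulr_natl.
  rewrite mi0 mul0r; apply/eqP; rewrite mcoeff_eq0 mulrC.
  rewrite (perm_mem (msuppMX _ _)); apply/mapP => -[m' _ mE].
  by move: mi0; rewrite mE mnmDE mnm1E eqxx.
rewrite (eq_bigr _ (fun i _ => coefXd i)) -mulr_suml.
have [->|fm] := eqVneq f@_m 0; first by rewrite !mulr0.
rewrite -natr_sum; congr (_%:R * _).
have /(dhomog_mf fd) <- : m \in msupp f by rewrite mcoeff_msupp.
rewrite /= mdegE; symmetry.
by rewrite (reindex _ (onW_bij _ (enum_rank_bij V))).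
Qed.


Lemma mderiv_XM i j f :
  'd_i ('X_(enum_rank j) * f) = (i == j)%:R *: f + 'X_(enum_rank j) * 'd_i f.
Proof.
rewrite mderivM mderivX mnm1E (inj_eq enum_rank_inj) eq_sym; congr (_ + _).
have [->|ij] := eqVneq i j; last by rewrite scale0r !scale0r mul0r.
rewrite !scale1r (_ : _ - _ = 0)%MM ?mpolyX0 ?mul1r //.
by apply/mnmP => k; rewrite mnmBE subnn mnm0E.
Qed.

(* A closed homogeneous 1-form is exact: Euler's formula gives a primitive.   *)
Lemma primitive d (h : V -> {polyOn R, V}) :
    (forall i, h i \is d.-homog) -> (forall i j, 'd_i (h j) = 'd_j (h i)) ->
  let f := d.+1%:R^-1 *: \sum_j 'X_(enum_rank j) * h j in
  f \is d.+1.-homog /\ forall i, 'd_i f = h i.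
Proof.
move=> hd hC f; split.
  rewrite rpredZ // rpred_sum // => j _; rewrite -add1n dhomogM //.
  by rewrite dhomogX /= mdeg1.
move=> i; rewrite mderivZ (raddf_sum (mderiv (enum_rank i))) /=.
transitivity (d.+1%:R^-1 *: \sum_j ((i == j)%:R *: h j +
    'X_(enum_rank j) * 'd_j (h i)) : {polyOn R, V}).
  congr (_ *: _); apply: eq_bigr => j _; rewrite -hC; apply: mderiv_XM.
rewrite big_split (euler (hd i)) /=.
rewrite (bigD1 i) //= big1 ?addr0 ?eqxx ?scale1r; last first.
  by move=> j; rewrite eq_sym => /negPf ->; rewrite scale0r.
rewrite -{1}[h i]scale1r -scalerDl scalerA nat1r mulVf ?scale1r //.
by rewrite pnatr_eq0.
Qed.

Lemma dset0 f : dset set0 f = f.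
Proof.
rewrite /dset (_ : [multinom _ | _ < _] = 0%MM) ?mderivm0m //.
by apply/mnmP => k; rewrite mnmE inE mnm0E.
Qed.

Lemma dsetU1 i S f : i \notin S -> dset (i |: S) f = 'd_i (dset S f).
Proof.
move=> iS; rewrite /dset -mderivmU1m -mderivmDm; congr mderivm.
apply/mnmP => k; rewrite mnmDE !mnmE !inE.
have [ki|ki] := eqVneq (enum_val k) i; last first.
  rewrite (_ : (enum_rank i == k) = false) ?addn0 //.
  by apply: contra_neqF ki => /eqP <-; rewrite enum_rankK.
by rewrite ki (negPf iS) -ki enum_valK eqxx.
Qed.

Lemma dset1 i f : dset [set i] f = 'd_i f.
Proof. by rewrite -(setU0 [set i]) dsetU1 ?inE // dset0. Qed.

Lemma dset_ind (P : {polyOn R, V} -> {polyOn R, V} -> Prop) S f g :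
  P f g -> (forall i f g, P f g -> P ('d_i f) ('d_i g)) -> P (dset S f) (dset S g).
Proof.
move=> Pfg Pd; elim: {S}_.+1 {-2}S (ltnSn #|S|) => // n IH S.
have [->|[i iS]] := set_0Vmem S; first by rewrite !dset0.
rewrite (cardsD1 i) iS ltnS => Sn; rewrite -(setD1K iS) !dsetU1 ?setD11 //.
exact/Pd/IH.
Qed.

Lemma ddir_dset u S f : ddir u (dset S f) = dset S (ddir u f).
Proof.
by apply: (@dset_ind (fun f g => ddir u f = g)) => // j ? ? <-; rewrite mderiv_ddir.
Qed.

Lemma dset_set0 S : dset S (0 : {polyOn R, V}) = 0.
Proof.
by apply: (@dset_ind (fun f g => f = 0) S 0 0) => // j ? ? ->; rewrite linear0.
Qed.

Lemma dsetB S f g : dset S (f - g) = dset S f - dset S g.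
Proof. exact: mderivmB. Qed.

Lemma dset_homog S d f : f \is d.-homog -> dset S f \is (d - #|S|).-homog.
Proof.
elim: {S}_.+1 {-2}S (ltnSn #|S|) => // n IH S.
have [->|[i iS]] := set_0Vmem S; first by rewrite dset0 cards0 subn0.
rewrite (cardsD1 i) iS ltnS => Sn fd; rewrite -{1}(setD1K iS) dsetU1 ?setD11 //.
by rewrite add1n subnS; apply/mderiv_homog/IH.
Qed.

Lemma dsetU S T f : [disjoint S & T] -> dset (S :|: T) f = dset S (dset T f).
Proof.
elim: {S}_.+1 {-2}S (ltnSn #|S|) => // n IH S.
have [->|[i iS]] := set_0Vmem S; first by rewrite dset0 set0U.
rewrite (cardsD1 i) iS ltnS => Sn ST.
have iT : i \notin T by rewrite (disjointFr ST iS).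
rewrite -(setD1K iS) -setUA !dsetU1 ?setD11 ?IH //; first last.
- by rewrite !inE eqxx.
- by rewrite (disjointWl _ ST) ?subD1set.
Qed.

Lemma dset_sub S T f : S \subset T -> dset S f = 0 -> dset T f = 0.
Proof.
move=> ST Sf; rewrite -(setID T S) (setIidPr ST) setUC dsetU ?Sf ?dset_set0 //.
by rewrite -setI_eq0; apply/eqP/setP => x; rewrite !inE; case: (x \in S);
  rewrite ?andbF.
Qed.

Lemma complex_of_down S T f :
  S \subset T -> T \in complex_of f -> S \in complex_of f.
Proof.
by move=> ST; rewrite !inE; apply: contraNneq => /(dset_sub ST) ->.
Qed.

(** For [f] homogeneous of degree [size ws] this is its polar form: the iterated derivative is then
    a constant, read off at the monomial 1. *)
Definition polar f (ws : seq {ffun V -> R}) : R := (foldr (@ddir R V) f ws)@_0%MM.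

Lemma foldr_ddir u f ws :
  foldr (@ddir R V) (ddir u f) ws = ddir u (foldr (@ddir R V) f ws).
Proof. by elim: ws => //= w ws ->; rewrite ddirC. Qed.

Lemma polar_cons u f ws : polar (ddir u f) ws = polar f (u :: ws).
Proof. by rewrite /polar /= -foldr_ddir. Qed.

Lemma polar_mderiv i f ws : polar ('d_i f) ws = polar f (basis_vec i :: ws).
Proof. by rewrite -polar_cons ddir_basis. Qed.

Lemma eq0_of_polar d f : f \is d.-homog ->
  (forall ws, size ws = d -> polar f ws = 0) -> f = 0.
Proof.
elim: d f => [|d IH] f fd f0.
  by rewrite (homog0_const fd) -/(polar f [::]) f0 // scale0r.
apply: (eq0_of_mderiv fd) => i; apply: IH; first exact: (mderiv_homog i fd).
by move=> ws wsd; rewrite polar_mderiv f0 //= wsd.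
Qed.

Definition hess h (i j : V) : R := ('d_i ('d_j h))@_0%MM.

Lemma hessC h i j : hess h i j = hess h j i.
Proof. by rewrite /hess mderivC_comm. Qed.

Lemma bform_hess h u w : bform (hess h) u w = (ddir u (ddir w h))@_0%MM.
Proof.
rewrite /bform {1}/ddir raddf_sum; apply: eq_bigr => i _ /=.
rewrite mcoeffZ mderiv_ddir /ddir raddf_sum mulr_sumr; apply: eq_bigr => j _ /=.
by rewrite mcoeffZ /hess mderivC_comm; ring.
Qed.

End Derivatives.

(** * Volume polynomials of balanced complexes *)

Section DerivativesAlong.
Variables (R : realType) (V : finType).
Implicit Types (f h : {polyOn R, V}) (l m : {ffun V -> R}) (S : {set V}).

Lemma ddir_sum_notin l S h : {in S, forall j, l j = 0} ->
  ddir l h = \sum_(k | k \notin S) l k *: 'd_k h.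
Proof.
move=> lS; rewrite /ddir (bigID (mem S)) /= big1 ?add0r // => k kS.
by rewrite lS // scale0r.
Qed.

(** On [S] the vector [l] is the basis vector at [j], so invariance along [l] expresses the
    derivative at [j] through derivatives outside [S]. *)
Lemma mderiv_of_ddir l S j h : j \in S -> {in S, forall k, l k = (k == j)%:R} ->
  ddir l h = 0 -> 'd_j h = - \sum_(k | k \notin S) l k *: 'd_k h.
Proof.
move=> jS lS lh; apply/eqP; rewrite -addr_eq0; apply/eqP; rewrite -[RHS]lh.
rewrite /ddir [RHS](bigID (mem S)) /=; congr (_ + _).
rewrite (bigD1 j) //= big1 ?addr0 ?lS ?eqxx ?scale1r // => k /andP[kS /negPf kj].
by rewrite lS // kj scale0r.
Qed.

End DerivativesAlong.

(** * Uniqueness and existence from heredity, purity and balancing *)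

Section VolumePolynomial.
Variables (R : realType) (V : finType) (Delta : {set {set V}}).
Variables (L : {ffun V -> R} -> Prop) (d : nat).
Hypothesis Delta_down : forall S T : {set V}, S \subset T -> T \in Delta -> S \in Delta.
Hypothesis L_sub : forall l m, L l -> L m -> L (l - m).
Hypothesis L_scale : forall a l, L l -> L [ffun i => a * l i].
Hypothesis hered : hereditary_pair Delta L.
Hypothesis Delta0 : set0 \in Delta.
Hypothesis card_Delta : forall S : {set V}, S \in Delta -> (#|S| <= d)%N.

(** Descending induction on the size of the face: outside [S] the derivatives of [dset S (f - g)]
    belong to larger faces or to non-faces, and inside [S] they are combinations of those by
    invariance. *)
Lemma uniqueness_of_vol f g :
    f \is d.-homog -> g \is d.-homog ->
    complex_of f = Delta -> complex_of g = Delta ->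
    (forall l : {ffun V -> R}, L l -> lineality f l) -> (forall l : {ffun V ->
      R}, L l -> lineality g l) ->
    (forall S : {set V}, S \in Delta -> #|S| = d -> dset S f = dset S g) ->
  f = g.
Proof.
move=> fd gd fD gD fL gL fg; apply/eqP; rewrite -subr_eq0; apply/eqP.
have out (S : {set V}) : S \notin Delta -> dset S (f - g) = 0.
  move=> SD; rewrite dsetB.
  have [] : S \notin complex_of f /\ S \notin complex_of g by rewrite fD gD.
  by rewrite !inE !negbK => /eqP -> /eqP ->; rewrite subrr.
suff vanish n (S : {set V}) : S \in Delta -> (#|S| + n = d)%N -> dset S (f - g) = 0.
  by rewrite -[LHS]dset0 (vanish d) // cards0.
elim: n S => [|n IH] S SD Sn; first by rewrite dsetB fg ?subrr // -Sn addn0.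
have hh : dset S (f - g) \is n.+1.-homog.
  by rewrite -(addKn #|S| n.+1) Sn dset_homog // rpredB.
have dnotin k : k \notin S -> 'd_k (dset S (f - g)) = 0.
  move=> kS; rewrite -dsetU1 //.
  have [kD|] := boolP (k |: S \in Delta); last exact: out.
  by rewrite IH // cardsU1 kS /= add1n addSnnS.
apply: (eq0_of_mderiv hh) => j.
have [jS|] := boolP (j \in S); last exact: dnotin.
have [l [Ll lS]] := hered SD [ffun k => (k == j)%:R].
rewrite (mderiv_of_ddir (l := l) jS); first 1 last.
- by move=> k kS; rewrite lS // ffunE.
- by rewrite ddir_dset linearB /= (fL l Ll) (gL l Ll) subrr dset_set0.
by rewrite big1 ?oppr0 // => k kS; rewrite dnotin // scaler0.
Qed.

Hypothesis pure : forall S : {set V}, S \in Delta -> (#|S| < d)%N ->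
  exists2 i, i \notin S & i |: S \in Delta.
Hypothesis balanced : forall S : {set V}, S \in Delta -> #|S|.+1 = d ->
  forall l : {ffun V -> R}, L l -> {in S, forall i, l i = 0} ->
  \sum_(k | (k \notin S) && (k |: S \in Delta)) l k = 0.

(** [G n S] is the candidate for [dset S f] in degree n = d - #|S|, integrated from the gradient
    that the larger faces prescribe; [f] is [G d set0]. *)
Lemma existence_of_vol : exists f : {polyOn R, V},
  [/\ f \is d.-homog, complex_of f = Delta, forall l : {ffun V -> R}, L l ->
    lineality f l
    & forall S : {set V}, S \in Delta -> #|S| = d -> dset S f = 1].
Proof.
have /boolp.choice[lv lvP] (Sj : {set V} * V) : exists l, Sj.1 \in Delta ->
    L l /\ {in Sj.1, forall k, l k = (k == Sj.2)%:R}.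
  have [SD|SD] := boolP (Sj.1 \in Delta); last by exists 0.
  have [l [Ll lS]] := hered SD [ffun k => (k == Sj.2)%:R].
  by exists l => _; split=> // k kS; rewrite lS // ffunE.
pose step (G : {set V} -> {polyOn R, V}) (S : {set V}) (k : V) : {polyOn R, V} :=
  if k |: S \in Delta then G (k |: S) else 0.
(* For j in S, the derivative is forced by invariance along [lv (S, j)]. *)
pose grad G (S : {set V}) (j : V) : {polyOn R, V} := if j \in S
  then - \sum_(k | k \notin S) lv (S, j) k *: step G S k else step G S j.
pose G := fix G n S : {polyOn R, V} := if n is n'.+1
  then n'.+1%:R^-1 *: \sum_j 'X_(enum_rank j) * grad (G n') S j else 1.
(* The last clause makes the family compatible: a derivative at an outer vertex is the member
   attached to the larger face. At n = 0 it holds because [card_Delta] forbids larger faces. *)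
have invariant n (S : {set V}) : S \in Delta -> (#|S| + n = d)%N ->
    [/\ G n S \is n.-homog, forall l : {ffun V -> R}, L l -> ddir l (G n S) = 0
      & forall j, j \notin S -> 'd_j (G n S) = step (G n.-1) S j].
  elim: n S => [|n IH] S SD Sn.
    split=> [|l _|j jS]; first exact: dhomog1.
      by rewrite /ddir big1 // => i _; rewrite mderiv_homog0 ?scaler0 ?dhomog1.
    rewrite mderiv_homog0 ?dhomog1 // /step; case: ifP => // /card_Delta.
    by rewrite cardsU1 jS -Sn addn0 ltnn.
  set h0 := step (G n) S; set h := grad (G n) S.
  have h0P k : k \notin S -> [/\ h0 k \is n.-homog, forall l : {ffun V ->
    R}, L l -> ddir l (h0 k) = 0
      & forall j, j \notin S -> j != k -> 'd_j (h0 k) = step (fun T =>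
        step (G n.-1) T j) S k].
    move=> kS; rewrite /h0 /step; case: ifP => [kD|_]; last first.
      by split=> [|l _|j _ _]; rewrite ?rpred0 ?linear0.
    have [|h1 h2 h3] := IH (k |: S) kD; first by rewrite cardsU1 kS add1n addSnnS.
    by split=> // j jS jk; rewrite h3 // !inE negb_or jk.
  have h0C j k : j \notin S -> k \notin S -> 'd_j (h0 k) = 'd_k (h0 j).
    move=> jS kS; have [->//|jk] := eqVneq j k.
    have [_ _ ->//] := h0P k kS; have [_ _ ->//] := h0P j jS; last by rewrite eq_sym.
    rewrite /step setUCA; case D: (k |: (j |: S) \in Delta); last by rewrite !if_same.
    by rewrite !(Delta_down _ D) ?setUS ?subsetUr.
  have lvS j : L (lv (S, j)) /\ {in S, forall k, lv (S, j) k = (k == j)%:R}.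
    exact: (lvP (S, j)).
  have dS q j : (forall l : {ffun V -> R}, L l -> ddir l q = 0) -> j \in S ->
      'd_j q = - \sum_(k | k \notin S) lv (S, j) k *: 'd_k q.
    by move=> Lq jS; have [Ll lS] := lvS j; apply: mderiv_of_ddir => //; apply: Lq.
  have hE j : h j = if j \in S then - \sum_(k | k \notin S) lv (S, j) k *: h0 k
      else h0 j by [].
  have dh i j : j \in S -> 'd_i (h j) = - \sum_(k | k \notin S) lv (S,
    j) k *: 'd_i (h0 k).
    move=> jS; rewrite hE jS mderivN (raddf_sum (mderiv (enum_rank i))) /=.
    by congr (- _); apply: eq_bigr => k _; rewrite mderivZ.
  have h_homog j : h j \is n.-homog.
    rewrite hE; case: ifP => [_|/negbT jS]; last by have [] := h0P j jS.
    by rewrite rpredN rpred_sum // => k kS; rewrite rpredZ //; have [] := h0P k kS.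
  (* Both indices outside [S]: [h0C]. One inside: invariance of the outer [h0] rewrites its
     derivative. Both inside: each side is a double sum over outer vertices, and [h0C] exchanges the
     two. *)
  have h_closed i j : 'd_i (h j) = 'd_j (h i).
    wlog: i j / (i \in S) ==> (j \in S) => [wl|].
      have [iS|iS] := boolP (i \in S); last by apply: wl; rewrite (negPf iS).
      have [jS|jS] := boolP (j \in S); first by apply: wl; rewrite jS implybT.
      by symmetry; apply: wl; rewrite (negPf jS).
    have [jS _|jS] := boolP (j \in S); last first.
      rewrite implybF => iS; rewrite !hE (negPf iS) (negPf jS); exact: h0C.
    have [iS|iS] := boolP (i \in S); last first.
      rewrite dh // [h i]hE (negPf iS) [RHS]dS //; last by have [] := h0P i iS.
      by congr (- _); apply: eq_bigr => k kS; rewrite h0C.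
    have dd (a b : V) : a \in S -> b \in S -> 'd_a (h b) = \sum_(k | k \notin S)
        \sum_(m | m \notin S) (lv (S, b) k * lv (S, a) m) *: 'd_m (h0 k).
      move=> aS bS; rewrite dh // -sumrN; apply: eq_bigr => k kS.
      rewrite dS //; last by have [] := h0P k kS.
      by rewrite scalerN opprK scaler_sumr; apply: eq_bigr => m _; rewrite scalerA.
    rewrite !dd // exchange_big; apply: eq_bigr => m mS; apply: eq_bigr => k kS.
    by rewrite h0C // mulrC.
  have [G_homog dG] := primitive h_homog h_closed.
  split=> [//|l Ll|j jS]; last by rewrite dG hE (negPf jS).
  (* [m] is [l] corrected to vanish on [S]; the correction matches the inner components of [grad],
     so the derivative along [l] involves only outer vertices. *)
  pose m := l - \sum_(j in S) [ffun k => l j * lv (S, j) k].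
  have Lm : L m.
    apply: L_sub => //; apply: (big_ind L) => [|u w Lu Lw|j jS].
    - by have := L_sub Ll Ll; rewrite subrr.
    - have L0w : L (0 - w) by apply: L_sub => //; have := L_sub Ll Ll; rewrite subrr.
      by rewrite -[w]opprK -(sub0r w); apply: L_sub.
    - by apply: L_scale; have [] := lvS j.
  have mE k : m k = l k - \sum_(j in S) l j * lv (S, j) k.
    by rewrite !ffunE sum_ffunE; congr (_ - _); apply: eq_bigr => j _; rewrite ffunE.
  have mS : {in S, forall k, m k = 0}.
    move=> k kS; rewrite mE (bigD1 k) //= big1 ?addr0.
      by have [_ ->] := lvS k; rewrite // eqxx mulr1 subrr.
    move=> j /andP[jS jk]; have [_ ->//] := lvS j.
    by rewrite eq_sym (negPf jk) mulr0.
  have qE : ddir l (G n.+1 S) = \sum_(k | k \notin S) m k *: h0 k.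
    have hS : \sum_(j in S) l j *: h j
        = - \sum_(k | k \notin S) \sum_(j in S) (l j * lv (S, j) k) *: h0 k.
      rewrite [in RHS]exchange_big -sumrN; apply: eq_bigr => j jS.
      rewrite hE jS scalerN scaler_sumr; congr (- _).
      by apply: eq_bigr => k _; rewrite scalerA.
    rewrite /ddir (eq_bigr (fun j => l j *: h j)) => [|j _]; last by rewrite dG.
    rewrite (bigID (mem S)) /= hS addrC -sumrB; apply: eq_bigr => k kS.
    by rewrite hE (negPf kS) mE scalerBl scaler_suml.
  rewrite qE; set q := \sum_(k | _) _.
  have Lq l' : L l' -> ddir l' q = 0.
    move=> Ll'; rewrite linear_sum big1 //= => k kS.
    by rewrite linearZ /=; have [_ -> //] := h0P k kS; rewrite scaler0.
  (* For n = 0, [q] is the constant of the balancing condition. Otherwise its gradient vanishes: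
     outside [S], closedness turns it into the derivative along [m] of an invariant [h0]; inside
     [S], invariance of [q] applies. *)
  have [n0|n_gt0] := posnP n.
    have -> : q = (\sum_(k | (k \notin S) && (k |: S \in Delta)) m k) *: 1.
      rewrite scaler_suml /q big_mkcondr; apply: eq_bigr => k _.
      by rewrite /h0 /step n0; case: ifP => _; rewrite ?scaler0.
    by rewrite balanced ?scale0r // -Sn n0 addn1.
  have q_homog : q \is n.-1.+1.-homog.
    rewrite prednK // rpred_sum // => k kS.
    by rewrite rpredZ //; have [] := h0P k kS.
  have dq k : k \notin S -> 'd_k q = 0.
    move=> kS; rewrite (raddf_sum (mderiv (enum_rank k))) /=.
    have [_ h0L _] := h0P k kS.
    rewrite -[RHS](h0L m Lm) (ddir_sum_notin _ mS); apply: eq_bigr => j jS.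
    by rewrite mderivZ h0C.
  apply: (eq0_of_mderiv q_homog) => j.
  have [jS|] := boolP (j \in S); last exact: dq.
  by rewrite dS // big1 ?oppr0 // => k kS; rewrite dq ?scaler0.
(* Purity leads from any face to one of size [d], where [G] is 1. Thus no face drops out of the
   complex of [f]. *)
have G0 n (S : {set V}) : S \in Delta -> (#|S| + n = d)%N -> G n S != 0.
  elim: n S => [|n IH] S SD Sn; first exact: oner_neq0.
  have [|i iS iD] := pure SD; first by rewrite -Sn addnS ltnS leq_addr.
  have [_ _ /(_ i iS)] := invariant _ _ SD Sn; rewrite /step iD => dG.
  have : G n (i |: S) != 0 by apply: IH; rewrite ?cardsU1 ?iS ?add1n ?addSnnS.
  by rewrite -dG; apply: contraNneq => ->; rewrite linear0.
have [f_homog f_L _] := invariant d set0 Delta0 ltac:(by rewrite cards0).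
set f := G d set0 in f_homog f_L.
have dsetE n (S : {set V}) : #|S| = n -> dset S f =
  if S \in Delta then G (d - n)%N S else 0.
  elim: n S => [|n IH] S.
    by move/eqP; rewrite cards_eq0 => /eqP ->; rewrite dset0 Delta0 subn0.
  move=> Sn; have [i iS] : exists i, i \in S.
    by apply/set0Pn; rewrite -card_gt0 Sn.
  have := Sn; rewrite (cardsD1 i) iS add1n => -[S'n].
  rewrite -{1}(setD1K iS) dsetU1 ?setD11 // IH //; case: ifP => S'D; last first.
    case: ifP => SD; last by rewrite linear0.
    by move: S'D; rewrite (Delta_down (subD1set S i)).
  have n_lt : (n <= d)%N by rewrite -S'n; apply: card_Delta.
  have [|_ _ dG] := invariant (d - n)%N _ S'D; first by rewrite S'n subnKC.
  by rewrite dG ?setD11 // /step setD1K // -subnS.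
exists f; split=> // [|S SD Sd]; last by rewrite (dsetE d) // SD subnn.
apply/setP => S; rewrite inE (dsetE #|S|) //; case: ifP => SD; last by rewrite eqxx.
by apply: G0; rewrite // subnKC // card_Delta.
Qed.

End VolumePolynomial.

(** * Links *)

Section Substitution.
Variables (R : realType) (V W : finType) (r : V -> option W).

Definition coord_subst : #|V|.-tuple {polyOn R, W} :=
  [tuple if r (enum_val k) is Some j then 'X_(enum_rank j) else 0 | k < #|V|].

(** The linear map dual to [coord_subst]. For [r = insub] the substitution is the one in [flink],
    and this map extends a vector of the link by zero. *)
Definition coord_ext (w : {ffun W -> R}) : {ffun V -> R} :=
  [ffun i => if r i is Some j then w j else 0].

Lemma ddirM (U : finType) (u : {ffun U -> R}) (f g : {polyOn R, U}) :
  ddir u (f * g) = ddir u f * g + f * ddir u g.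
Proof.
rewrite /ddir mulr_suml mulr_sumr -big_split; apply: eq_bigr => i _ /=.
by rewrite mderivM scalerDr scalerAl scalerAr.
Qed.

Lemma ddir1 (U : finType) (u : {ffun U -> R}) : ddir u (1 : {polyOn R, U}) = 0.
Proof.
by rewrite /ddir big1 // => i _; rewrite mderiv_homog0 ?dhomog1 ?scaler0.
Qed.

Lemma ddirX (U : finType) (u : {ffun U -> R}) i :
  ddir u ('X_(enum_rank i) : {polyOn R, U}) = u i *: 1.
Proof.
have X1 : 'X_(enum_rank i) = 'X_(enum_rank i) * 1 :> {polyOn R, U} by rewrite mulr1.
rewrite /ddir (bigD1 i) //= big1 ?addr0 => [|j ji].
  rewrite X1 mderiv_XM eqxx scale1r mderiv_homog0 ?dhomog1 //.
  by rewrite mulr0 addr0.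
rewrite X1 mderiv_XM (negPf ji) scale0r mderiv_homog0 ?dhomog1 //.
by rewrite mulr0 addr0 scaler0.
Qed.

Lemma mpoly_ind_ring n (K : comNzRingType) (P : {mpoly K[n]} -> Prop) :
    P 1 -> (forall i, P 'X_i) -> (forall a f, P f -> P (a *: f)) ->
    (forall f g, P f -> P g -> P (f + g)) ->
    (forall f g, P f -> P g -> P (f * g)) ->
  forall f, P f.
Proof.
move=> P1 PX PZ PD PM; have P0 : P 0 by rewrite -(scale0r 1); apply: PZ.
elim/mpolyind => [//|c m p _ _ Pp]; apply: PD => //; apply: PZ.
rewrite mpolyXE_id; apply: big_ind => // i _.
by elim: (m i) => [|k IH]; rewrite ?expr0 // exprS; apply: PM.
Qed.

Lemma coef0_is_mult (U : finType) (f g : {polyOn R, U}) :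
  (f * g)@_0%MM = f@_0%MM * g@_0%MM.
Proof. exact: (mcoeff0_is_multiplicative _ _).1. Qed.

Lemma ddir_subst w (g : {polyOn R, V}) :
  ddir w (g \mPo coord_subst) = ddir (coord_ext w) g \mPo coord_subst.
Proof.
elim/mpoly_ind_ring: g w => [|k|a g IH|f g IHf IHg|f g IHf IHg] w.
- by rewrite comp_mpoly1 !ddir1 comp_mpoly0.
- rewrite comp_mpolyXU -tnth_nth tnth_mktuple -{2}(enum_valK k) ddirX.
  rewrite comp_mpolyZ comp_mpoly1 ffunE.
  by case: (r _) => [j|]; rewrite ?ddirX // linear0 scale0r.
- by rewrite comp_mpolyZ !linearZ /= IH.
- by rewrite comp_mpolyD !linearD /= IHf IHg.
- by rewrite rmorphM !ddirM rmorphD !rmorphM /= IHf IHg.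
Qed.

Lemma coef0_subst (g : {polyOn R, V}) : (g \mPo coord_subst)@_0%MM = g@_0%MM.
Proof.
elim/mpoly_ind_ring: g => [|k|a g IH|f g IHf IHg|f g IHf IHg].
- by rewrite comp_mpoly1 !mcoeff1 !eqxx.
- rewrite comp_mpolyXU -tnth_nth tnth_mktuple.
  case: (r _) => [j|]; rewrite ?mcoeff0 !mcoeffX.
    by rewrite -!mdeg_eq0 !mdeg1.
  by rewrite -mdeg_eq0 mdeg1.
- by rewrite comp_mpolyZ !mcoeffZ IH.
- by rewrite comp_mpolyD !mcoeffD IHf IHg.
- by rewrite rmorphM !coef0_is_mult IHf IHg.
Qed.

Lemma subst_homog d (g : {polyOn R, V}) :
  g \is d.-homog -> g \mPo coord_subst \is d.-homog.
Proof.
move=> gd; rewrite comp_mpolyEX big_seq rpred_sum // => m /(dhomog_mf gd) <-.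
rewrite rpredZ // comp_mpolyX /= mdegE.
apply: (big_ind2 (fun (p : {polyOn R, W}) k => p \is k.-homog)) => [|p1 k1 p2 k2|k _].
- exact: dhomog1.
- exact: dhomogM.
- rewrite -[X in X.-homog]mul1n; apply: dhomogMn; rewrite tnth_mktuple.
  by case: (r _) => [j|]; rewrite ?rpred0 // dhomogX /= mdeg1.
Qed.

End Substitution.

(** * The polynomial of a link and its complex *)

Section Links.
Variables (R : realType) (V : finType) (f : {polyOn R, V}).
Implicit Types (S : {set V}) (h : {polyOn R, V}) (v : {ffun V -> R}).

Lemma mem_lkvert S i :
  (i \in vertices (link (complex_of f) S)) = (i \notin S) && (i |: S \in complex_of f).
Proof. by rewrite /vertices /link inE [in LHS]inE disjoints1 setUC. Qed.

Lemma ddir_lineality l vs :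
  lineality f l -> ddir l (foldr (@ddir R V) f vs) = 0.
Proof.
move=> fl; rewrite -foldr_ddir fl; elim: vs => //= v vs ->; exact: linear0.
Qed.

Hypothesis hered : strongly_hereditary f.

Lemma lvecP S i : S \in complex_of f ->
  lineality f (lvec f S i) /\ {in S, forall j, lvec f S i j = (j == i)%:R}.
Proof.
move=> Sf; apply: (@classical_sets.xgetPex _ 0 (fun l : {ffun V -> R} =>
  lineality f l /\ {in S, forall j, l j = (j == i)%:R})).
have [l [fl lS]] := hered Sf [ffun j => (j == i)%:R].
by exists l; split=> // j jS; rewrite lS // ffunE.
Qed.

Local Notation ext S := (coord_ext (W := lkvert f S) (fun i : V => insub i)).

(** The two directions differ by a combination of the [lvec], along which [f] is invariant, and by
    coordinates at vertices outside [S] and its link, where the derivative of [dset S f]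
    vanishes. *)
Lemma ext_proj S v : S \in complex_of f ->
  ddir (ext S (proj f S v)) (dset S f) = ddir v (dset S f).
Proof.
move=> Sf; pose l : {ffun V -> R} := \sum_(i in S) [ffun j => v i * lvec f S i j].
have lE j : l j = \sum_(i in S) v i * lvec f S i j.
  by rewrite sum_ffunE; apply: eq_bigr => i _; rewrite ffunE.
have fl : ddir l (dset S f) = 0.
  rewrite ddir_dset.
  suff -> : ddir l f = 0 by rewrite dset_set0.
  rewrite /l; apply: (big_ind (fun u : {ffun V -> R} => ddir u f = 0)).
  - by rewrite /ddir big1 // => i _; rewrite ffunE scale0r.
  - by move=> u w u0 w0; rewrite ddirDl u0 w0 addr0.
  move=> i iS; have [fli _] := lvecP i Sf.
  rewrite /ddir (eq_bigr (fun j => v i *: (lvec f S i j *: 'd_j f))).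
    have e : \sum_j lvec f S i j *: 'd_j f = 0 := fli.
    by rewrite -scaler_sumr e scaler0.
  by move=> j _; rewrite ffunE scalerA.
rewrite -[RHS]subr0 -fl /ddir -sumrB; apply: eq_bigr => j _.
rewrite -scalerBl lE ffunE.
case: insubP => [k _ kj|]; first by rewrite ffunE kj.
rewrite mem_lkvert negb_and negbK scale0r; have [jS _|jS /= jf] := boolP (j \in S).
  rewrite (bigD1 j) //= big1 ?addr0.
    by have [_ ->//] := lvecP j Sf; rewrite eqxx mulr1 subrr scale0r.
  by move=> i /andP[iS ij]; have [_ ->//] := lvecP i Sf;
    rewrite eq_sym (negPf ij) mulr0.
by rewrite -dsetU1 //; move: jf; rewrite inE negbK => /eqP ->; rewrite scaler0.
Qed.

Lemma foldr_ext_proj S vs : S \in complex_of f ->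
  foldr (@ddir R V) (dset S f) [seq ext S (proj f S v) | v <- vs] =
  foldr (@ddir R V) (dset S f) vs.
Proof.
move=> Sf; elim: vs => //= v vs ->.
by rewrite -!foldr_ddir ext_proj.
Qed.

Lemma foldr_subst S h ws :
  foldr (@ddir R _) (h \mPo coord_subst R (fun i : V =>
    insub i : option (lkvert f S))) ws =
  foldr (@ddir R V) h (map (ext S) ws)
    \mPo coord_subst R (fun i : V => insub i : option (lkvert f S)).
Proof. by elim: ws => //= w ws ->; rewrite ddir_subst. Qed.

Lemma polar_link S vs : S \in complex_of f ->
  polar (dset S f) vs = polar (flink f S) (map (proj f S) vs).
Proof.
move=> Sf; rewrite /polar /flink -/(coord_subst _ _) foldr_subst coef0_subst.
by rewrite -map_comp foldr_ext_proj.
Qed.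

Lemma ext_basis S (j : lkvert f S) : ext S (basis_vec R j) = basis_vec R (val j).
Proof.
apply/ffunP => i; rewrite !ffunE; case: insubP => [k _ <-|ij].
  by rewrite ffunE (inj_eq val_inj).
rewrite (_ : (i == val j) = false) //.
by apply: contraNF ij => /eqP ->; apply: valP.
Qed.

Lemma disjoint_lkvert S (T : {set lkvert f S}) : [disjoint S & val @: T].
Proof.
rewrite disjoint_sym disjoint_subset; apply/subsetP => _ /imsetP[j _ ->].
by rewrite inE; have := valP j; rewrite mem_lkvert => /andP[].
Qed.

Lemma dset_flink S (T : {set lkvert f S}) :
  dset T (flink f S) = dset (val @: T) (dset S f)
    \mPo coord_subst R (fun i : V => insub i : option (lkvert f S)).
Proof.
elim: {T}_.+1 {-2}T (ltnSn #|T|) => // n IH T.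
have [->|[j jT]] := set_0Vmem T; first by rewrite imset0 !dset0.
rewrite (cardsD1 j) jT ltnS => Tn; rewrite -(setD1K jT) imsetU1.
rewrite !dsetU1 ?setD11 //; last first.
  by rewrite (mem_imset _ _ val_inj) setD11.
by rewrite IH // -ddir_basis ddir_subst ext_basis ddir_basis.
Qed.

(** The substitution loses nothing: by [ext_proj], every polar value of the derivative can be
    computed on vectors extended from the link. *)
Lemma subst_eq0 S T d : f \is d.-homog -> S \in complex_of f ->
    dset T (dset S f)
      \mPo coord_subst R (fun i : V => insub i : option (lkvert f S)) = 0 ->
  dset T (dset S f) = 0.
Proof.
move=> fd Sf h0; apply: (eq0_of_polar (dset_homog T (dset_homog S fd))) => vs _.
have dsetF U (g : {polyOn R, V}) ws :
    foldr (@ddir R V) (dset U g) ws = dset U (foldr (@ddir R V) g ws).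
  by elim: ws => //= w ws ->; rewrite ddir_dset.
rewrite /polar dsetF -(foldr_ext_proj _ Sf) -dsetF map_comp.
rewrite -[LHS](coef0_subst (fun i : V => insub i : option (lkvert f S))).
rewrite -foldr_subst h0 (_ : foldr _ _ _ = 0) ?mcoeff0 //.
by elim: (map _ vs) => //= w ws ->; apply: linear0.
Qed.

Lemma complex_of_flink d S (T : {set lkvert f S}) :
    f \is d.-homog -> S \in complex_of f ->
  (T \in complex_of (flink f S)) = (S :|: val @: T \in complex_of f).
Proof.
move=> fd Sf; rewrite !inE dset_flink setUC dsetU; last first.
  by rewrite disjoint_sym disjoint_lkvert.
congr (~~ _); apply/eqP/eqP => [|->]; last exact: comp_mpoly0.
exact: subst_eq0 fd Sf.
Qed.

End Links.

(* The conditions on codimension two or more from which the induction over the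
   cone recovers the Lorentzian property of all the links. *)
Record locally_Lorentzian (R : realType) (V : finType) (d : nat)
    (f : {polyOn R, V}) : Prop := LocallyLorentzian {
  loc_homog : f \is d.-homog;
  loc_neq0 : f != 0;
  loc_hered : strongly_hereditary f;
  loc_vertices : forall i, [set i] \in complex_of f;
  loc_connected : forall S : {set V}, S \in complex_of f -> (#|S| + 3 <= d)%N ->
    forall phi : V -> R,
      (forall i j, i \notin S -> j \notin S -> i != j ->
         i |: (j |: S) \in complex_of f -> phi i = phi j) ->
    forall i j, i \notin S -> i |: S \in complex_of f ->
      j \notin S -> j |: S \in complex_of f -> phi i = phi j;
  loc_quadric : forall S : {set V}, S \in complex_of f -> (#|S| + 2)%N = d ->
    exists c : V -> R, forall x : {ffun V -> R}, \sum_i c i * x i = 0 ->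
      polar (dset S f) [:: x; x] <= 0
}.

(** * Passage of the local conditions to links *)

Section LocallyLorentzianLink.
Variables (R : realType) (V : finType) (d : nat) (f : {polyOn R, V}).
Hypothesis fL : locally_Lorentzian d f.
Variable (S : {set V}).
Hypothesis Sf : S \in complex_of f.

Local Notation insubS := (fun i : V => insub i : option (lkvert f S)).
Local Notation ext := (coord_ext insubS).

(** A face [T] of the link corresponds to the face [S :|: val @: T], of the same codimension and
    with the same derivative up to substitution, so each condition at [T] comes from the one at that
    union. *)
Lemma flink_locally_Lorentzian : locally_Lorentzian (d - #|S|) (flink f S).
Proof.
have [fd f0 her verts conn quad] := fL.
have inlk := fun T => complex_of_flink her T fd Sf.
have card_im (T : {set lkvert f S}) : #|S :|: val @: T| = (#|S| + #|T|)%N.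
  rewrite cardsU (_ : S :&: _ = set0) ?cards0 ?subn0 ?card_imset //.
    exact: val_inj.
  by apply/eqP; rewrite setI_eq0 disjoint_lkvert.
have valS (j : lkvert f S) : val j \notin S /\ val j |: S \in complex_of f.
  by have := valP j; rewrite mem_lkvert => /andP[].
have UE (i : lkvert f S) (T : {set lkvert f S}) : S :|: val @: (i |: T) =
  val i |: (S :|: val @: T).
  by rewrite imsetU1 setUCA.
have mem_val (i : lkvert f S) (T : {set lkvert f S}) : (val i \in val @: T) = (i \in T).
  by apply/imsetP/idP => [[j jT /val_inj ->//]|iT]; exists i.
have notinU (i : lkvert f S) (T : {set lkvert f S}) : (val i \in S :|: val @: T) =
  (i \in T).
  by rewrite inE (negPf (valS i).1) mem_val.
split.
- by apply/subst_homog/dset_homog.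
- suff : set0 \in complex_of (flink f S) by rewrite inE dset0.
  by rewrite inlk imset0 setU0.
- move=> T; rewrite inlk => Tf a.
  (* Prescribing 0 on [S] makes [l] descend to the link: its other coordinates outside the link meet
     vanishing derivatives. *)
  have [l [fl lT]] := her _ Tf (ext a).
  exists [ffun j => l (val j)]; split=> [|j jT]; last first.
    rewrite ffunE lT; first by rewrite ffunE valK.
    by rewrite inE mem_val jT orbT.
  rewrite /lineality /flink -/(coord_subst _ _) ddir_subst.
  rewrite (_ : ddir _ _ = 0) ?comp_mpoly0 //.
  have lS : {in S, forall j, l j = 0}.
    move=> j jS; rewrite lT ?inE ?jS // ffunE insubF //.
    by apply: contraTF jS; rewrite mem_lkvert => /andP[].
  rewrite -[RHS](_ : ddir l (dset S f) = 0); last first.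
    by rewrite ddir_dset (fl : ddir l f = 0) dset_set0.
  apply: eq_bigr => j _; rewrite ffunE; case: insubP => [k _ <-|].
    by rewrite ffunE.
  rewrite mem_lkvert negb_and negbK scale0r => /orP[/lS ->|].
    by rewrite scale0r.
  have [/lS ->|jS] := boolP (j \in S); first by rewrite scale0r.
  by rewrite inE negbK -dsetU1 // => /eqP ->; rewrite scaler0.
- move=> i; rewrite inlk imset_set1 setUC; exact: (valS i).2.
- move=> T; rewrite inlk => Tf Td phi phiE i j iT iTf jT jTf.
  (* The default 0 is never compared, because neighbours of [S :|: val @: T] are vertices of the
     link of [S]. *)
  pose phi' (k : V) := if insubS k is Some k' then phi k' else 0.
  have phi'E k : phi k = phi' (val k) by rewrite /phi' valK.
  have to_lk k : k \notin S :|: val @: T -> k |: (S :|: val @: T) \in complex_of f ->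
      exists k' : lkvert f S, k = val k'.
    rewrite inE negb_or => /andP[kS _] kf.
    have klk : k \in vertices (link (complex_of f) S).
      by rewrite mem_lkvert kS (complex_of_down _ kf) // setUS // subsetUl.
    by exists (Sub k klk); rewrite SubK.
  rewrite !phi'E; apply: (conn (S :|: val @: T)) => //.
  + by rewrite card_im; lia.
  + move=> k m kST mST km kmf.
    have [k' kE] : exists k' : lkvert f S, k = val k'.
      by apply: to_lk => //; apply: complex_of_down kmf; rewrite setUS ?subsetUr.
    have [m' mE] : exists m' : lkvert f S, m = val m'.
      by apply: to_lk => //; apply: complex_of_down kmf; rewrite subsetUr.
    move: kST mST km kmf; rewrite {}kE {}mE !notinU -!phi'E => kT mT km kmf.
    by apply: phiE => //; rewrite inlk !UE.
  + by rewrite notinU.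
  + by rewrite -UE -inlk.
  + by rewrite notinU.
  + by rewrite -UE -inlk.
- move=> T; rewrite inlk => Tf Td.
  have [c cP] : exists c : V -> R, forall x : {ffun V -> R}, \sum_i c i * x i = 0 ->
      polar (dset (S :|: val @: T) f) [:: x; x] <= 0.
    by apply: quad => //; rewrite card_im; lia.
  exists (fun j => c (val j)) => x cx.
  have -> : polar (dset T (flink f S)) [:: x; x] =
      polar (dset (S :|: val @: T) f) [:: ext x; ext x].
    rewrite dset_flink setUC dsetU; last by rewrite disjoint_sym disjoint_lkvert.
    by rewrite /polar foldr_subst coef0_subst.
  apply: cP; rewrite -[RHS]cx (bigID (mem (vertices (link (complex_of f) S)))) /=.
  rewrite [X in _ + X]big1 ?addr0; last first.
    by move=> i /negPf ilk; rewrite ffunE insubF ?mulr0.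
  rewrite (reindex_omap val insubS) /=; last first.
    by move=> i ilk; rewrite insubT.
  apply: eq_big => [j|j _]; first by rewrite valK eqxx andbT (valP j).
  by rewrite ffunE valK.
Qed.

End LocallyLorentzianLink.

(** * Induction over the cone *)

Section Polarization.
Variables (R : realType) (V : finType) (f : {polyOn R, V}).
Implicit Types (v p l : {ffun V -> R}).

Lemma polarC u v vs : polar f (u :: v :: vs) = polar f (v :: u :: vs).
Proof. by rewrite /polar /= ddirC. Qed.

Lemma polar_rot u v w vs : polar f (u :: v :: w :: vs) = polar f (w :: u :: v :: vs).
Proof. by rewrite /polar /= (ddirC v) (ddirC u). Qed.

Lemma polar_expand p vs :
  polar f (p :: vs) = \sum_i p i * polar f (basis_vec R i :: vs).
Proof.
rewrite /polar /= {1}/ddir raddf_sum; apply: eq_bigr => i _ /=.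
by rewrite mcoeffZ ddir_basis.
Qed.

Lemma polar_lineality p l vs :
  lineality f l -> polar f (p + l :: vs) = polar f (p :: vs).
Proof. by move=> fl; rewrite /polar /= ddirDl (ddir_lineality vs fl) addr0. Qed.

Lemma bform_polar (u v : {ffun V -> R}) vs :
  bform (hess (foldr (@ddir R V) f vs)) u v = polar f (u :: v :: vs).
Proof. exact: bform_hess. Qed.

Lemma hess_polar i j vs : hess (foldr (@ddir R V) f vs) i j =
  polar f (basis_vec R i :: basis_vec R j :: vs).
Proof. by rewrite /hess /polar /= !ddir_basis. Qed.

Lemma hess_row i v vs : \sum_j hess (foldr (@ddir R V) f vs) i j * v j =
  polar f (basis_vec R i :: v :: vs).
Proof.
rewrite polarC polar_expand; apply: eq_bigr => j _.
by rewrite hess_polar polarC mulrC.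
Qed.

Lemma polar_linear v : f \is 1.-homog -> polar f [:: v] = peval f v.
Proof.
move=> f1; rewrite polar_expand /peval -{2}[f]scale1r -(euler f1) raddf_sum /=.
apply: eq_bigr => i _; rewrite mevalM mevalXU enum_rankK; congr (_ * _).
rewrite -polar_mderiv /polar /=.
rewrite [in RHS](homog0_const (mderiv_homog i f1)) mevalZ meval1 mulr1 //.
Qed.

End Polarization.

Section VertexLink.
Variables (R : realType) (V : finType) (f : {polyOn R, V}).
Hypothesis hered : strongly_hereditary f.
Variable i : V.
Hypothesis fi : [set i] \in complex_of f.

Lemma polar_vertex vs : polar f (basis_vec R i :: vs) =
  polar (flink f [set i]) (map (proj f [set i]) vs).
Proof.
rewrite -polar_link // -polar_mderiv; congr polar.
by rewrite dset1.
Qed.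

Lemma proj_basis (j : lkvert f [set i]) :
  proj f [set i] (basis_vec R (val j)) = basis_vec R j.
Proof.
apply/ffunP => k; rewrite !ffunE big_set1 ffunE (inj_eq val_inj).
have := valP j; rewrite mem_lkvert inE => /andP[/negPf ji _].
by rewrite (eq_sym i) ji mul0r subr0.
Qed.

End VertexLink.

Lemma cone_recS (R : realType) (V : finType) d (f : {polyOn R, V}) v :
    cone_rec d.+2 f v ->
  (exists p l : {ffun V -> R}, [/\ forall i, 0 < p i, lineality f l & v = p + l])
  /\ forall i, [set i] \in complex_of f ->
       cone_rec d.+1 (flink f [set i]) (proj f [set i] v).
Proof. by move=> [pl cv]; split=> // i fi; apply: cv; rewrite inE. Qed.

(** * Positivity and signature by induction on the degree *)

Section ConeInduction.
Variable R : realType.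

(** The index is shifted by one because the cone recursion starts with linear polynomials; that of
    [hyperbolic] is shifted by two because signatures start with quadrics. *)
Let positive d := forall (V : finType) (f : {polyOn R, V}) vs,
  locally_Lorentzian d.+1 f -> size vs = d.+1 ->
  (forall v, v \in vs -> cone_rec d.+1 f v) -> 0 < polar f vs.

Let hyperbolic d := forall (V : finType) (f : {polyOn R, V}) vs v,
  locally_Lorentzian d.+2 f -> size vs = d ->
  (forall v, v \in vs -> cone_rec d.+2 f v) -> cone_rec d.+2 f v ->
  neg_orth (hess (foldr (@ddir R V) f vs)) v.

Let vertex_link (V : finType) d (f : {polyOn R, V}) i :
  locally_Lorentzian d.+2 f ->
  [/\ strongly_hereditary f, [set i] \in complex_of f
    & locally_Lorentzian d.+1 (flink f [set i])].
Proof.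
move=> fL; have fi := loc_vertices fL i; split=> //; first exact: loc_hered fL.
by have := flink_locally_Lorentzian fL fi; rewrite cards1 subSS subn0.
Qed.

(** Write the first vector as [p + l]: [l] drops out, and [p] gives a positive combination of polar
    values of the vertex links, whose arguments stay in their cones. In degree one, positivity
    defines the cone. *)
Lemma cone_positive d : positive d.
Proof.
elim: d => [|d IH] V f vs fL.
  case: vs => [|v []] //= _ fv; rewrite polar_linear ?(loc_homog fL) //.
  by have := fv v; rewrite inE eqxx; apply.
case: vs => [//|v vs] [vsd] fv.
have [[p [l [p_gt0 fl ->]]] _] := cone_recS (fv v (mem_head _ _)).
rewrite polar_lineality // polar_expand.
have term i : 0 < p i * polar f (basis_vec R i :: vs).
  have [her fi fiL] := vertex_link i fL.
  rewrite mulr_gt0 // polar_vertex //; apply: IH => // [|_ /mapP[w wvs ->]].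
    by rewrite size_map.
  by have [_] := cone_recS (fv w ltac:(by rewrite inE wvs orbT)); apply.
(* The sum has a term, since a nonzero form of positive degree needs a variable. *)
have [i _|V0] := pickP (@predT V).
  by rewrite (bigD1 i) //= ltr_pwDl ?sumr_ge0 // => j _; rewrite ltW.
have := loc_neq0 fL; rewrite (eq0_of_mderiv (loc_homog fL)) ?eqxx // => i.
by have := V0 i.
Qed.

(** Degree two is settled by the hyperplane of [loc_quadric]. Above it, [trickle_down] is applied at
    the positive part [p] of the first vector [w], and [neg_orth_change] moves the conclusion to
    [v]. *)
Lemma cone_hyperbolic d : hyperbolic d.
Proof.
elim: d => [|d IH] V f vs v fL.
  move=> /size0nil -> _ fv.
  have vv : 0 < polar f [:: v; v].
    by apply: (@cone_positive 1) => // w; rewrite !inE orbb => /eqP ->.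
  have f0 : set0 \in complex_of f by rewrite inE dset0; apply: loc_neq0 fL.
  have [c cP] := loc_quadric fL f0 ltac:(by rewrite cards0).
  apply: (neg_orth_hyperplane (c := c)) => [i j|x cx|]; first exact: hessC.
    pose x' := [ffun i => x i]; have xx' : x =1 x' by move=> i; rewrite ffunE.
    rewrite (eq_bform _ xx' xx') (bform_polar f x' x' [::]) -[f]dset0; apply: cP.
    by rewrite -[RHS]cx; apply: eq_bigr => i _; rewrite ffunE.
  by rewrite bform_polar.
case: vs => [//|w vs] [vsd] fvs fv.
set F := foldr _ f _.
have her := loc_hered fL; have fw := fvs w (mem_head _ _).
have [[p [l [p_gt0 fl wE]]] _] := cone_recS fw.
have hC i j : hess F i j = hess F j i by apply: hessC.
have vv : 0 < bform (hess F) v v.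
  rewrite bform_polar; apply: (cone_positive fL); first by rewrite /= vsd.
  by move=> u; rewrite inE => /orP[/eqP -> //|]; rewrite inE => /orP[/eqP -> //|/fvs].
apply: (neg_orth_change (v := p)) => //.
have swap u ws : polar f (u :: p :: ws) = polar f (u :: w :: ws).
  by rewrite polarC wE [RHS]polarC polar_lineality.
have link_cone i u : u \in w :: vs ->
    cone_rec d.+2 (flink f [set i]) (proj f [set i] u).
  move=> uvs; have [_] := cone_recS (fvs u uvs); apply; exact: (loc_vertices fL).
have q_gt0 i : 0 < \sum_j hess F i j * p j.
  have [_ fi fiL] := vertex_link i fL.
  rewrite hess_row swap polar_vertex //; apply: (cone_positive fiL).
    by rewrite /= size_map vsd.
  move=> _ /mapP[u uvs ->]; apply: link_cone.
  by move: uvs; rewrite inE => /orP[/eqP ->|//]; rewrite mem_head.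
have off_face i j : i != j -> [set i; j] \notin complex_of f -> hess F i j = 0.
  move=> ij; rewrite inE negbK => /eqP ijf.
  rewrite hess_polar -!polar_mderiv mderivC_comm.
  have -> : 'd_i ('d_j f) = dset [set i; j] f.
    by rewrite dsetU1 ?dset1 // inE.
  by rewrite ijf /polar (_ : foldr _ _ _ = 0) ?mcoeff0 //;
    elim: (w :: vs) => //= u us ->;
    exact: linear0.
(* The entry at an edge is a polar value two links down, at the vertex [j] of the link of [i], where
   the projected vectors are still in the cone. *)
have on_face i j : i != j -> [set i; j] \in complex_of f -> 0 < hess F i j.
  move=> ij ijf; have [_ fi fiL] := vertex_link i fL.
  have jlk : j \in vertices (link (complex_of f) [set i]).
    by rewrite mem_lkvert inE eq_sym ij setUC.
  have jE : j = val (Sub j jlk : lkvert f [set i]) by rewrite SubK.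
  rewrite hess_polar polar_vertex //= jE proj_basis.
  have [her' jfi fijL] := vertex_link (Sub j jlk) fiL.
  rewrite polar_vertex // -map_cons -map_comp; apply: (cone_positive fijL).
    by rewrite size_map /= vsd.
  move=> _ /mapP[u uvs ->]; have [_] := cone_recS (link_cone i u uvs).
  by apply.
apply: trickle_down => // [i j ij|phi phiE i j|x].
- have [/(on_face _ _ ij)/ltW//|/(off_face _ _ ij)->//] := boolP ([set i;
  j] \in complex_of f).
- have f0 : set0 \in complex_of f by rewrite inE dset0; apply: loc_neq0 fL.
  apply: (loc_connected fL f0); rewrite ?in_set0 ?cards0 //.
  + move=> k m _ _ km kmf; apply: phiE => //; apply: on_face => //.
    by rewrite setU0 in kmf.
  + by rewrite setU0; exact: (loc_vertices fL).
  + by rewrite setU0; exact: (loc_vertices fL).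
(* The form is the sum of [p i] times the form B_i of the link of [i]. Reverse Cauchy-Schwarz bounds
   B_i(x,x) by B_i(x,w)^2 / B_i(w,w), and these two values are the i-th row of the Hessian at [x]
   and at [p]. *)
pose x' := [ffun i => x i]; have xx' : x =1 x' by move=> i; rewrite ffunE.
rewrite (eq_bform _ xx' xx') bform_polar polar_rot wE polar_lineality //.
rewrite polar_expand; apply: ler_sum => i _.
have -> : \sum_j hess F i j * x j = \sum_j hess F i j * x' j.
  by apply: eq_bigr => j _; rewrite ffunE.
rewrite !hess_row swap -mulrA ler_pM2l // mulrC ler_pdivlMr.
  have [_ fi fiL] := vertex_link i fL.
  rewrite !polar_vertex //= -!bform_polar; apply: reverse_CS.
  - exact: hessC.
  - rewrite bform_polar; apply: (cone_positive fiL); first by rewrite /= size_map vsd.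
    move=> u; rewrite !inE orbA orbb => /orP[/eqP ->|/mapP[u' u'vs ->]].
      by apply: link_cone; rewrite mem_head.
    by apply: link_cone; rewrite inE u'vs orbT.
  - apply: IH => //; first by rewrite size_map.
      move=> _ /mapP[u uvs ->]; apply: link_cone; by rewrite inE uvs orbT.
    by apply: link_cone; rewrite mem_head.
by rewrite -swap -hess_row.
Qed.

End ConeInduction.

(** * From polar forms to Lorentzian polynomials *)

Lemma pdeg_homog (R : realType) (V : finType) d (f : {polyOn R, V}) :
  f \is d.-homog -> f != 0 -> pdeg f = d.
Proof. by move=> fd f0; apply: (dhomog_uniq f0 (dhomog_msize fd) fd). Qed.

Lemma gram_one_positive (R : realType) (V : finType) (F : {polyOn R, V}) v :
    0 < bform (hess F) v v -> neg_orth (hess F) v ->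
  one_positive_eigenvalue (gram (fun x y => (ddir x (ddir y F))@_0%MM)).
Proof.
move=> v_gt0 neg; set G := gram _.
have GE k m : G k m = hess F (enum_val k) (enum_val m).
  by rewrite mxE -/(basis_vec R _) -/(basis_vec R _) !ddir_basis.
have formE (x y : V -> R) :
    mxform G (\row_k x (enum_val k)) (\row_k y (enum_val k)) = bform (hess F) x y.
  have sumV (g : V -> R) : \sum_i g i = \sum_(k < #|V|) g (enum_val k).
    by rewrite (reindex _ (onW_bij _ (enum_val_bij V))).
  rewrite /mxform -mulmxA mxE bformE sumV; apply: eq_bigr => k _.
  rewrite !mxE sumV; congr (_ * _); apply: eq_bigr => m _.
  by rewrite GE !mxE.
apply: (one_positive_eigenvalueP (v := \row_k v (enum_val k))).
- by apply/matrixP => k m; rewrite mxE !GE hessC.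
- by rewrite formE.
move=> x; pose y i := x 0 (enum_rank i).
have -> : x = \row_k y (enum_val k) by apply/rowP => k; rewrite mxE /y enum_valK.
by rewrite !formE; apply: neg.
Qed.

Lemma Lorentzian_on_cone (R : realType) (V : finType) d (f : {polyOn R, V}) :
  (0 < d)%N -> locally_Lorentzian d f -> Lorentzian_on (cone f) f.
Proof.
move=> d0 fL; have fd := pdeg_homog (loc_homog fL) (loc_neq0 fL).
split; rewrite fd /cone ?fd; first exact: loc_homog fL.
  by move=> d00; rewrite d00 in d0.
move=> _ v vK; have vK' u : u \in val v -> cone_rec d f u.
  by move=> /tnthP[k ->]; apply: vK.
case: d d0 v vK vK' fL fd => // d _ v vK vK' fL fd; split.
  apply: (cone_positive fL) => //; exact: size_tuple.
case: d v vK vK' fL fd => // d v vK vK' fL fd _.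
have dropK u : u \in drop 2 v -> cone_rec d.+2 f u by move=> /mem_drop; apply: vK'.
have sz : size (drop 2 v) = d by rewrite size_drop size_tuple subn2.
apply: (@gram_one_positive _ _ _ (tnth v ord0)).
  rewrite bform_polar; apply: (cone_positive fL); first by rewrite /= sz.
  move=> u; rewrite !inE orbA orbb => /orP[/eqP ->|/dropK //]; exact: vK.
by apply: (cone_hyperbolic fL) => //; apply: vK.
Qed.

(** Faces in [tau] have fewer than [d] elements, so their link polynomials have positive degree and
    the cone induction applies to them. *)
Lemma locally_Lorentzian_hereditary (R : realType) (V : finType) d (f : {polyOn R, V}) :
    (forall S, S \in tau (complex_of f) -> (#|S| < d)%N) ->
  locally_Lorentzian d f -> hereditary_Lorentzian f.
Proof.
move=> tau_d fL; split=> [S|S]; rewrite inE => /andP[St Sf].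
  exact: (loc_hered fL).
apply: (@Lorentzian_on_cone _ _ (d - #|S|)); last exact: flink_locally_Lorentzian.
by rewrite subn_gt0 tau_d // inE St.
Qed.

(** * Flats of a matroid *)

Section Matroid.
Local Open Scope nat_scope.
Variables (E : finType) (M : matroid E).
Implicit Types (A B F G I J X : {set E}) (e : E).
Local Notation rk := (mrank M).

Lemma rk_indep I A : I \in indep M -> I \subset A -> #|I| <= rk A.
Proof. by move=> IM IA; rewrite /mrank (bigD1 I) ?IM // leq_maxl. Qed.

Lemma rk_basis A : exists2 I, I \in indep M & I \subset A /\ #|I| = rk A.
Proof.
have /(eq_bigmax_cond (fun I : {set E} => #|I|)) :
    0 < #|[pred I : {set E} | (I \in indep M) && (I \subset A)]|.
  by apply/card_gt0P; exists set0; rewrite inE indep_set0 sub0set.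
by case=> I /andP[IM IA] E0; exists I => //; rewrite /mrank -E0.
Qed.

Lemma rk_mono A B : A \subset B -> rk A <= rk B.
Proof.
have [I IM [IA <-]] := rk_basis A => AB.
by apply: rk_indep => //; apply: subset_trans AB.
Qed.

Lemma indep_extend I A : I \in indep M -> I \subset A ->
  exists2 J, J \in indep M & [/\ I \subset J, J \subset A & #|J| = rk A].
Proof.
elim: {I}_.+1 {-2}I (ltnSn (rk A - #|I|)) => // n IH I.
rewrite ltnS => In IM IA.
have [K KM [KA KE]] := rk_basis A.
have [|IK] := leqP (rk A) #|I|.
  by move=> AI; exists I => //; split=> //; apply/eqP; rewrite eqn_leq AI rk_indep.
rewrite -KE in IK; have [e] := indep_aug IM KM IK.
rewrite inE => /andP[eI eK] eIM.
have eIA : e |: I \subset A by rewrite subUset IA sub1set (subsetP KA).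
have [|J JM [IJ JA JE]] := IH _ _ eIM eIA.
  by rewrite cardsU1 eI; lia.
by exists J => //; split=> //; apply: subset_trans IJ; apply: subsetUr.
Qed.

Lemma rk_add A e : rk (e |: A) <= (rk A).+1.
Proof.
have [I IM [IA <-]] := rk_basis (e |: A).
have := @rk_indep (I :\ e) A (indep_sub IM (subD1set I e)).
rewrite subDset => /(_ IA); have := cardsD1 e I; case: (e \in I); lia.
Qed.

(** Extend a basis [I] of [A] to [J] in [B] and to [K] in [e |: B]. If the rank grew, [K] contains
    [e], and [e |: I] is an independent subset of [e |: A] that is too large. *)
Lemma rk_closed A B e : A \subset B -> rk (e |: A) = rk A -> rk (e |: B) = rk B.
Proof.
move=> AB eA; apply/eqP; rewrite eqn_leq [X in _ && X]rk_mono ?subsetUr // andbT.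
rewrite leqNgt; apply/negP => eB.
have eNB : e \notin B.
  by apply: contraTN eB => eB; rewrite (setUidPr _) ?ltnn // sub1set.
have [I IM [IA IE]] := rk_basis A.
have [J JM [IJ JB JE]] := indep_extend IM (subset_trans IA AB).
have [K KM [JK KB KE]] := indep_extend JM (subset_trans JB (subsetUr [set e] B)).
have eK : e \in K.
  apply: contraTT eB => eNK; rewrite -leqNgt -KE; apply: rk_indep => //.
  apply/subsetP => x xK; have := subsetP KB x xK; rewrite !inE.
  by case/orP => // /eqP xe; rewrite -xe xK in eNK.
have eIK : e |: I \subset K by rewrite subUset sub1set eK (subset_trans IJ JK).
have := @rk_indep (e |: I) (e |: A) (indep_sub KM eIK) (setUS _ IA).
rewrite eA -IE cardsU1 (_ : e \in I = false) ?ltnn //.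
by apply: contraNF eNB => /(subsetP IA)/(subsetP AB).
Qed.

Definition closure A : {set E} := [set e | rk (e |: A) == rk A].

Lemma sub_closure A : A \subset closure A.
Proof. by apply/subsetP => e eA; rewrite inE (setUidPr _) ?sub1set. Qed.

Lemma rk_closure A : rk (closure A) = rk A.
Proof.
suff H n B : #|B| <= n -> B \subset closure A -> rk (B :|: A) = rk A.
  by rewrite -(H _ _ (leqnn _) (subxx _)) (setUidPl (sub_closure A)).
elim: n B => [|n IH] B.
  by rewrite leqn0 cards_eq0 => /eqP -> _; rewrite set0U.
have [->|[e eB]] := set_0Vmem B; first by rewrite set0U.
rewrite (cardsD1 e) eB add1n ltnS => Bn BA.
have BA' : B :\ e \subset closure A by apply: subset_trans BA; apply: subD1set.
rewrite -(setD1K eB) -setUA (@rk_closed A) ?subsetUr //; first exact: IH.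
by have := subsetP BA e eB; rewrite inE => /eqP.
Qed.

Lemma flat_rk F e : flat M F -> e \notin F -> rk (e |: F) = (rk F).+1.
Proof.
move=> /forallP/(_ e)/implyP flF /flF Fe.
by apply/eqP; rewrite eqn_leq rk_add.
Qed.

Lemma closure_min A F : flat M F -> A \subset F -> closure A \subset F.
Proof.
move=> flF AF; apply/subsetP => e; rewrite inE => /eqP eA.
apply: contraT => eF; have := flat_rk flF eF; rewrite (rk_closed AF) //; lia.
Qed.

Lemma closure_flat A : flat M (closure A).
Proof.
apply/forallP => e; apply/implyP; apply: contraR; rewrite -leqNgt rk_closure.
move=> eA; rewrite inE eqn_leq (leq_trans _ eA) ?rk_mono ?subsetUr //.
by rewrite setUS // sub_closure.
Qed.

Lemma flat_rk_lt F G : flat M F -> F \subset G -> F != G -> rk F < rk G.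
Proof.
move=> flF FG FnG; have /properP[_ [e eG eF]] : F \proper G by rewrite properEneq FnG.
by rewrite -(flat_rk flF eF) rk_mono // subUset FG sub1set eG.
Qed.

Lemma flat_eq F G : flat M F -> F \subset G -> rk G <= rk F -> F = G.
Proof.
move=> flF FG GF; apply/eqP; apply: contraTT GF => FnG.
by rewrite -ltnNge flat_rk_lt.
Qed.

Lemma rk_cover F e : flat M F -> e \notin F -> rk (closure (e |: F)) = (rk F).+1.
Proof. by move=> flF eF; rewrite rk_closure flat_rk. Qed.

Lemma flat_setT : flat M [set: E].
Proof. by apply/forallP => e; rewrite inE. Qed.

Lemma rk_set0 : rk set0 = 0.
Proof.
have [I _ [I0 <-]] := rk_basis set0.
by move: I0; rewrite subset0 => /eqP ->; rewrite cards0.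
Qed.

(** Seen as a closure, the set of loops is a flat contained in every flat. *)
Lemma loopsE : loops M = closure set0.
Proof.
apply/setP => e; rewrite !inE setU0 rk_set0; apply/idP/eqP.
  move=> eN; have [I IM [Ie <-]] := rk_basis [set e].
  move: Ie; rewrite subset1 => /orP[/eqP Ie|/eqP ->]; last exact: cards0.
  by rewrite -Ie IM in eN.
by move=> e0; apply: contra_eqN e0 => /rk_indep/(_ (subxx _)); rewrite cards1; lia.
Qed.

Lemma loops_flat : flat M (loops M).
Proof. by rewrite loopsE closure_flat. Qed.

Lemma loops_sub F : flat M F -> loops M \subset F.
Proof. by move=> flF; rewrite loopsE closure_min ?sub0set. Qed.

Lemma rk_loops : rk (loops M) = 0.
Proof. by rewrite loopsE rk_closure rk_set0. Qed.

(** Adding an element of [B] and closing up raises the rank by exactly one and stays inside [B]. *)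
Lemma flat_between A B k : flat M A -> A \subset B -> flat M B -> rk A <= k <= rk B ->
  exists2 F, flat M F & [/\ A \subset F, F \subset B & rk F = k].
Proof.
move=> flA AB flB /andP[].
elim: k => [|k IH]; first by rewrite leqn0 => /eqP A0 _; exists A.
rewrite leq_eqVlt => /orP[/eqP <- _|]; first by exists A.
rewrite ltnS => Ak kB; have [F flF [AF FB Fk]] := IH Ak (ltnW kB).
have /properP[_ [e eB eF]] : F \proper B.
  by rewrite properEneq FB andbT; apply: contraTneq kB => <-; rewrite Fk ltnn.
have eFB : e |: F \subset B by rewrite subUset FB sub1set eB.
exists (closure (e |: F)); first exact: closure_flat.
split; last by rewrite rk_cover ?Fk.
  by apply: subset_trans (sub_closure _); apply: subset_trans AF (subsetUr _ _).
exact: closure_min.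
Qed.

End Matroid.

(** * The order complex *)

Section OrderComplex.
Local Open Scope nat_scope.
Variables (E : finType) (M : matroid E).
Implicit Types (A B X Y : {set E}) (F G H : proper_flat M) (S T : {set proper_flat M}).
Local Notation rk := (mrank M).
Local Notation r := (mrank M [set: E]).
Local Notation Delta := (order_complex M).

Definition incl_cmp A B := (A \subset B) || (B \subset A).

Lemma incl_cmpC A B : incl_cmp A B = incl_cmp B A.
Proof. exact: orbC. Qed.

Lemma incl_cmpxx A : incl_cmp A A.
Proof. by rewrite /incl_cmp subxx. Qed.

Lemma incl_cmp_rk A B : flat M A -> flat M B -> incl_cmp A B -> rk A <= rk B ->
  A \subset B.
Proof.
by move=> flA flB /orP[//|BA] AB; rewrite (flat_eq flB BA AB).
Qed.

Lemma proper_flatP F : flat M (val F).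
Proof. by have /and3P[] := valP F. Qed.

Lemma proper_flat_rk F : 0 < rk (val F) < r.
Proof.
have /and3P[flF Fl FE] := valP F; apply/andP; split.
  by rewrite -(rk_loops M); apply: flat_rk_lt; rewrite ?loops_flat ?loops_sub // eq_sym.
by apply: flat_rk_lt; rewrite ?subsetT.
Qed.

Lemma exists_proper_flat X : flat M X -> 0 < rk X < r -> exists F, val F = X.
Proof.
move=> flX /andP[X0 Xr]; have XP : [&& flat M X, X != loops M & X != [set: E]].
  rewrite flX /=; apply/andP; split.
    by apply: contraTneq X0 => ->; rewrite rk_loops.
  by apply: contraTneq Xr => ->; rewrite ltnn.
by exists (Sub X XP : proper_flat M); rewrite SubK.
Qed.

Lemma DeltaP S : reflect {in S &, forall F G, incl_cmp (val F) (val G)} (S \in Delta).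
Proof.
rewrite inE; apply: (iffP forall_inP) => [h F G FS GS|h F FS].
  by have /forall_inP := h F FS; apply.
by apply/forall_inP => G GS; apply: h.
Qed.

Lemma Delta_down S T : S \subset T -> T \in Delta -> S \in Delta.
Proof.
by move=> /subsetP ST /DeltaP TD; apply/DeltaP => F G /ST FT /ST; apply: TD.
Qed.

Lemma Delta_set0 : set0 \in Delta.
Proof. by apply/DeltaP => F G; rewrite inE. Qed.

Lemma DeltaU1 F S : S \in Delta -> {in S, forall G, incl_cmp (val F) (val G)} ->
  F |: S \in Delta.
Proof.
move=> /DeltaP SD FS; apply/DeltaP => G H.
rewrite !inE => /predU1P[->|GS] /predU1P[->|HS]; rewrite ?incl_cmpxx //.
- exact: FS.
- by rewrite incl_cmpC FS.
- exact: SD.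
Qed.

Lemma DeltaU1_cmp F S : F |: S \in Delta -> {in S, forall G, incl_cmp (val F) (val G)}.
Proof. by move=> /DeltaP h G GS; apply: h; rewrite !inE ?eqxx ?GS ?orbT. Qed.

Lemma Delta_rk_inj S : S \in Delta -> {in S &, injective (fun F => rk (val F))}.
Proof.
move=> /DeltaP SD F G FS GS FG; apply: val_inj; apply/eqP; rewrite eqEsubset.
by rewrite !incl_cmp_rk ?proper_flatP ?SD ?FG.
Qed.

(** A chain occupies each rank at most once, so the codimension of a face is its number of free
    ranks; links are studied through them. *)
Definition missing S k := (0 < k < r) && [forall F in S, rk (val F) != k].

Lemma card_missing S (ks : seq nat) : S \in Delta -> uniq ks -> all (missing S) ks ->
  #|S| + size ks <= r.-1.
Proof.
move=> SD ku /allP km; pose s := [seq rk (val F) | F <- enum S].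
have -> : #|S| = size s by rewrite size_map cardE.
rewrite -size_cat -(size_iota 1 r.-1); apply: uniq_leq_size.
  rewrite cat_uniq ku andbT map_inj_in_uniq ?enum_uniq; last first.
    by move=> F G; rewrite !mem_enum; apply: Delta_rk_inj.
  apply/hasPn => k /km /andP[_ /forall_inP kS].
  by apply/mapP => -[F]; rewrite mem_enum => /kS + kF; rewrite kF eqxx.
move=> k; rewrite mem_cat mem_iota => /orP[/mapP[F _ ->]|/km/andP[+ _]].
  by have := proper_flat_rk F; lia.
by lia.
Qed.

Lemma card_Delta S : S \in Delta -> #|S| <= r.-1.
Proof. by move=> SD; have := @card_missing S [::] SD isT isT; rewrite addn0. Qed.

Lemma exists_missing S : S \in Delta -> #|S| < r.-1 -> exists k, missing S k.
Proof.
move=> SD Sr; pose s := [seq rk (val F) | F <- enum S].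
have : ~~ all (mem s) (iota 1 r.-1).
  apply: contraTN Sr => /allP sub; rewrite -leqNgt cardE -(size_map (fun F =>
    rk (val F))).
  by rewrite -(size_iota 1 r.-1); apply: uniq_leq_size => //; apply: iota_uniq.
move=> /allPn[k]; rewrite mem_iota => kr ks; exists k.
rewrite /missing; apply/andP; split; first by lia.
apply/forall_inP => F FS; apply: contraNneq ks => <-.
by apply: (map_f (fun F => rk (val F))); rewrite mem_enum.
Qed.

(** Adding the least and the greatest flat gives every gap of the chain both its ends. *)
Definition ext_chain S : {set {set E}} := loops M |: ([set: E] |: val @: S).

Lemma ext_chainP S X : reflect (X = loops M \/ X = [set: E] \/ exists2 F,
  F \in S & X = val F)
  (X \in ext_chain S).
Proof.
rewrite !inE; apply: (iffP or3P).
  by case=> [/eqP|/eqP|/imsetP]; [left|right; left|right; right].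
case=> [->|[->|[F FS ->]]]; [exact: Or31|exact: Or32|apply: Or33].
exact: imset_f.
Qed.

Lemma loops_ext S : loops M \in ext_chain S. Proof. by rewrite !inE eqxx. Qed.
Lemma setT_ext S : [set: E] \in ext_chain S. Proof. by rewrite !inE eqxx orbT. Qed.
Lemma val_ext S F : F \in S -> val F \in ext_chain S.
Proof. by move=> FS; rewrite !inE imset_f ?orbT. Qed.

Lemma ext_flat S X : X \in ext_chain S -> flat M X.
Proof.
by case/ext_chainP => [->|[->|[F _ ->]]]; rewrite ?loops_flat ?flat_setT ?proper_flatP.
Qed.

Lemma ext_cmp S X Y : flat M Y -> {in S, forall G, incl_cmp Y (val G)} ->
  X \in ext_chain S -> incl_cmp Y X.
Proof.
move=> flY YS /ext_chainP[->|[->|[F FS ->]]]; last exact: YS.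
  by rewrite /incl_cmp loops_sub ?orbT.
by rewrite /incl_cmp subsetT.
Qed.

Lemma ext_chain_cmp S X Y : S \in Delta -> X \in ext_chain S -> Y \in ext_chain S ->
  incl_cmp X Y.
Proof.
move=> SD XS YS; apply: (ext_cmp (ext_flat XS)) YS => G GS.
rewrite incl_cmpC; apply: (ext_cmp (proper_flatP G)) XS => H HS.
by move/DeltaP: SD; apply.
Qed.

Lemma link_below F S X : F |: S \in Delta -> X \in ext_chain S ->
  rk X <= rk (val F) -> X \subset val F.
Proof.
move=> FS XS; apply: incl_cmp_rk; rewrite ?proper_flatP ?(ext_flat XS) //.
by rewrite incl_cmpC; apply: (ext_cmp (proper_flatP F)) XS; apply: DeltaU1_cmp.
Qed.

Lemma link_above F S X : F |: S \in Delta -> X \in ext_chain S ->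
  rk (val F) <= rk X -> val F \subset X.
Proof.
move=> FS XS; apply: incl_cmp_rk; rewrite ?proper_flatP ?(ext_flat XS) //.
by apply: (ext_cmp (proper_flatP F)) XS; apply: DeltaU1_cmp.
Qed.

Lemma ext_rank S k : k <= r -> missing S k \/ exists2 X, X \in ext_chain S & rk X = k.
Proof.
move=> kr; have [kS|kS] := boolP (missing S k); [by left|right].
move: kS; rewrite /missing negb_and => /orP[k0|/forall_inPn[F FS]].
  have [->|kN0] := eqVneq k 0; first by exists (loops M); rewrite ?loops_ext ?rk_loops.
  by exists [set: E]; [apply: setT_ext | lia].
by rewrite negbK => /eqP <-; exists (val F); rewrite ?val_ext.
Qed.

Lemma missing_notin S k F : missing S k -> rk (val F) = k -> F \notin S.
Proof.
by move=> /andP[_ /forall_inP kS] Fk; apply: contra_eqN Fk => /kS.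
Qed.

(** A flat of rank [k] is inserted between the highest member below rank [k] and the lowest member
    above it in the completed chain. *)
Lemma link_of_missing S k : S \in Delta -> missing S k ->
  exists F, [/\ rk (val F) = k, F \notin S & F |: S \in Delta].
Proof.
move=> SD kS; have /andP[kr /forall_inP kN] := kS.
pose below X := (X \in ext_chain S) && (rk X < k).
pose above X := (X \in ext_chain S) && (k < rk X).
have b0 : below (loops M) by rewrite /below loops_ext rk_loops; lia.
have a0 : above [set: E] by rewrite /above setT_ext; lia.
case: (arg_maxnP rk b0) => A /andP[AS Ak] Amax.
case: (arg_minnP rk a0) => B /andP[BS kB] Bmin.
have AB : A \subset B.
  by apply: incl_cmp_rk; rewrite ?(ext_flat AS) ?(ext_flat BS) ?(ext_chain_cmp SD)
    //; lia.
have [X flX [AX XB Xk]] := flat_between (k := k) (ext_flat AS) AB (ext_flat BS)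
  ltac:(lia).
have [F FX] := exists_proper_flat flX ltac:(by rewrite Xk).
exists F; rewrite FX; split=> //; first by apply: (missing_notin kS); rewrite FX.
apply: DeltaU1 => // G GS; rewrite FX.
have := val_ext GS; have := kN G GS; rewrite neq_ltn => /orP[Gk|kG] Gext.
  rewrite incl_cmpC /incl_cmp (subset_trans _ AX) //.
  apply: incl_cmp_rk; rewrite ?(ext_flat AS) ?proper_flatP ?(ext_chain_cmp SD) //.
  by apply: Amax; rewrite /below Gext.
rewrite /incl_cmp (subset_trans XB) //.
apply: incl_cmp_rk; rewrite ?(ext_flat BS) ?proper_flatP ?(ext_chain_cmp SD) //.
by apply: Bmin; rewrite /above Gext.
Qed.

Lemma Delta_pure S : S \in Delta -> #|S| < r.-1 ->
  exists2 F, F \notin S & F |: S \in Delta.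
Proof.
move=> SD Sr; have [k kS] := exists_missing SD Sr.
by have [F [_ FS FSD]] := link_of_missing SD kS; exists F.
Qed.

End OrderComplex.

(** * Modular vectors *)

Section Modular.
Variables (R : realType) (E : finType) (M : matroid E).
Implicit Types (A X : {set E}) (c : E -> R) (F G : proper_flat M) (S T : {set
  proper_flat M}).
Local Notation rk := (mrank M).
Local Notation r := (mrank M [set: E]).
Local Notation Delta := (order_complex M).
Local Notation modular := (@modular_vector R E M).

(** Extends a modular vector from proper flats to all sets; it vanishes at the loops and, when the
    weights sum to 0, at the whole ground set. *)
Definition csum c X : R := \sum_(i in X :\: loops M) c i.

Lemma modular_sub l m : modular l -> modular m -> modular (l - m).
Proof.
move=> [c [c0 lc]] [b [b0 mb]]; exists (fun i => c i - b i); split.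
  by rewrite sumrB c0 b0 subrr.
by move=> F; rewrite !ffunE lc mb sumrB.
Qed.

Lemma modular_add l m : modular l -> modular m -> modular (l + m).
Proof.
move=> [c [c0 lc]] [b [b0 mb]]; exists (fun i => c i + b i); split.
  by rewrite big_split /= c0 b0 addr0.
by move=> F; rewrite !ffunE lc mb big_split.
Qed.

Lemma modular0 : modular 0.
Proof.
by exists (fun=> 0); split=> [|F]; rewrite ?ffunE big1.
Qed.

Lemma modular_scale a l : modular l -> modular [ffun F => a * l F].
Proof.
move=> [c [c0 lc]]; exists (fun i => a * c i); split.
  by rewrite -mulr_sumr c0 mulr0.
by move=> F; rewrite ffunE lc mulr_sumr.
Qed.

Lemma sum_delta (X : {set E}) (t : R) e :
  \sum_(i in X) (i == e)%:R * t = (e \in X)%:R * t.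
Proof.
have [eX|eX] := boolP (e \in X).
  rewrite (bigD1 e) //= big1 ?addr0 ?eqxx // => i /andP[_ /negPf ->].
  by rewrite mul0r.
rewrite mul0r big1 // => i iX; rewrite (_ : (i == e) = false) ?mul0r //.
by apply: contraNF eX => /eqP <-.
Qed.

Lemma csum_loops c : csum c (loops M) = 0.
Proof. by rewrite /csum setDv big_set0. Qed.

Lemma csum_setT c : csum c [set: E] = \sum_(i in ~: loops M) c i.
Proof. by rewrite /csum setTD. Qed.

Lemma csum_split c A X : loops M \subset A -> A \subset X ->
  csum c X = csum c A + \sum_(i in X :\: A) c i.
Proof.
move=> /subsetP lA /subsetP AX; rewrite /csum (big_setID A) /=; congr (_ + _).
  apply: eq_bigl => i; rewrite in_setI !in_setD -andbA; congr (_ && _).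
  by have [/AX ->|] := boolP (i \in A); rewrite ?andbF.
apply: eq_bigl => i; rewrite !in_setD.
have [//|iA /=] := boolP (i \in A); have [/lA|//] := boolP (i \in loops M).
by rewrite (negPf iA).
Qed.

Lemma csum_ext0 (l : {ffun proper_flat M -> R}) c S X :
    \sum_(i in ~: loops M) c i = 0 -> (forall F, l F = csum c (val F)) ->
    {in S, forall F, l F = 0} -> X \in ext_chain S ->
  csum c X = 0.
Proof.
move=> c0 lc lS /ext_chainP[->|[->|[F FS ->]]]; first exact: csum_loops.
  by rewrite csum_setT.
by rewrite -lc lS.
Qed.

(** Induction removing the flat [F] of largest rank. Its value is corrected by a weight [t] at a
    point of [F] outside its predecessor [A], compensated at a point outside [F]; the smaller flats
    of the chain contain neither point. *)
Lemma modular_hereditary : hereditary_pair Delta modular.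
Proof.
move=> T TD a.
suff [c [c0 ca]] : exists c, \sum_(i in ~: loops M) c i = 0
    /\ {in T, forall F, csum c (val F) = a F}.
  exists [ffun F => csum c (val F)]; split; last by move=> F FT; rewrite ffunE ca.
  by exists c; split=> // F; rewrite ffunE.
elim: {T}_.+1 {-2}T (ltnSn #|T|) TD => // n IH T Tn TD.
have [->|[F0 F0T]] := set_0Vmem T.
  by exists (fun=> 0); split=> [|F]; rewrite ?inE // big1.
case: (arg_maxnP (fun F => rk (val F)) F0T) => F FT Fmax.
have {}FT : F \in T by [].
pose T' := T :\ F.
have T'D : T' \in Delta by apply: Delta_down TD; apply: subD1set.
have [|c' [c'0 c'a]] := IH T' _ T'D; first by move: Tn; rewrite (cardsD1 F) FT.
have Frk := proper_flat_rk F.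
pose below X := (X \in ext_chain T') && (rk X < rk (val F))%N.
have b0 : below (loops M) by rewrite /below loops_ext rk_loops; lia.
case: (arg_maxnP rk b0) => A /andP[AT' AF] Amax.
have FT'D : F |: T' \in Delta by rewrite setD1K.
have subAF : A \subset val F by apply: (link_below FT'D AT'); apply: ltnW.
have /properP[_ [e eF eA]] : A \proper val F.
  by rewrite properEneq subAF andbT; apply: contraTneq AF => ->; rewrite ltnn.
have /subsetPn[e' _ e'F] : ~~ ([set: E] \subset val F).
  by apply/negP => /(rk_mono M); rewrite leqNgt; case/andP: Frk => _ ->.
have lA := loops_sub (ext_flat AT'); have lF := loops_sub (proper_flatP F).
have el : e \notin loops M by apply: contraNN eA => /(subsetP lA).
have e'l : e' \notin loops M by apply: contraNN e'F => /(subsetP lF).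
pose t := a F - csum c' (val F).
pose c i := c' i + (i == e)%:R * t - (i == e')%:R * t.
have sumc X : \sum_(i in X) c i =
    \sum_(i in X) c' i + (e \in X)%:R * t - (e' \in X)%:R * t.
  by rewrite sumrB big_split /= !sum_delta.
exists c; split; first by rewrite sumc c'0 !in_setC el e'l !mul1r add0r subrr.
move=> G GT; rewrite /csum sumc -/(csum c' (val G)) !in_setD el e'l /=.
have [->|GF] := eqVneq G F; first by rewrite eF (negPf e'F) mul1r mul0r subr0 /t
  addrC subrK.
have GT' : G \in T' by rewrite !inE GF.
have GFr : (rk (val G) < rk (val F))%N.
  have GFle : (rk (val G) <= rk (val F))%N := Fmax G GT.
  rewrite ltn_neqAle GFle andbT; apply: contra GF => /eqP GFr.
  by apply/eqP; apply: (Delta_rk_inj TD).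
have GA : val G \subset A.
  apply: (incl_cmp_rk (M := M)); rewrite ?proper_flatP ?(ext_flat AT') //.
    by apply: (ext_chain_cmp T'D) => //; apply: val_ext.
  by apply: Amax; rewrite /below val_ext.
have eG : e \notin val G by apply: contraNN eA => /(subsetP GA).
have e'G : e' \notin val G.
  by apply: contraNN e'F => e'G; apply: (subsetP subAF); apply: (subsetP GA).
by rewrite (negPf eG) (negPf e'G) c'a // !mul0r addr0 subr0.
Qed.

(** By counting, a chain of codimension one has a single free rank, which a new member must
    occupy. *)
Lemma link_rank T k F : T \in Delta -> #|T|.+1 = r.-1 -> missing T k ->
  F \notin T -> F |: T \in Delta -> rk (val F) = k.
Proof.
move=> TD Tr kT FT FTD; apply/eqP; apply: contraT => Fk.
have kFT : missing (F |: T) k.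
  move: kT => /andP[k0 /forall_inP kT]; rewrite /missing k0 /=.
  by apply/forall_inP => G; rewrite !inE => /predU1P[->//|/kT].
have := @card_missing _ M _ [:: k] FTD isT; rewrite /= kFT cardsU1 FT => /(_ isT).
by lia.
Qed.

(* The flats covering [A] inside [C] partition [C :\: A]. *)
Lemma csum_cover A C k c : flat M A -> flat M C -> A \subset C ->
    rk A = k.-1 -> rk C = k.+1 -> (0 < k)%N ->
  \sum_(F : proper_flat M | [&& A \subset val F, val F \subset C & rk (val F) == k])
    \sum_(i in val F :\: A) c i = \sum_(i in C :\: A) c i.
Proof.
move=> flA flC AC rA rC k0; rewrite (exchange_big_dep (mem (C :\: A))) /=; last first.
  move=> F i /and3P[_ FC _]; rewrite !inE => /andP[-> iF]; exact: (subsetP FC).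
apply: eq_bigr => i; rewrite inE => /andP[iA iC].
have rcl : rk (closure M (i |: A)) = k by rewrite rk_cover ?rA ?prednK.
have rCr : (rk C <= r)%N by rewrite rk_mono ?subsetT.
have [F0 F0E] := exists_proper_flat (closure_flat M (i |: A)) ltac:(by rewrite rcl;
  lia).
rewrite (big_pred1 F0) // => F /=; apply/idP/eqP => [|->].
  rewrite inE => /andP[/and3P[AF FC /eqP rF] /andP[_ iF]].
  apply: val_inj; rewrite F0E; symmetry; apply: (flat_eq (M := M));
    rewrite ?closure_flat //.
    by apply: closure_min; rewrite ?proper_flatP // subUset sub1set iF.
  by rewrite rF rcl.
have sub := sub_closure M (i |: A).
rewrite F0E rcl eqxx (subset_trans (subsetUr _ _) sub) inE iA.
rewrite (subsetP sub) ?inE ?eqxx //= !andbT.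
by apply: closure_min => //; rewrite subUset sub1set iC.
Qed.

(** [A] and [C] are the members of the completed chain of ranks k - 1 and k + 1. The neighbours of
    [T] are the rank-k flats between them, to which the partition [csum_cover] applies. The bound on
    the rank of [A] serves in [hess_diag]. *)
Lemma link_sum T k : T \in Delta -> #|T|.+1 = r.-1 -> missing T k ->
  exists A C, [/\ A \in ext_chain T, C \in ext_chain T, (rk A < k)%N
    & forall c, csum c A = 0 ->
      \sum_(F : proper_flat M | (F \notin T) &&
        (F |: T \in Delta)) csum c (val F) = csum c C].
Proof.
move=> TD Tr kT; have /andP[kr /forall_inP kN] := kT.
have other j : (j <= r)%N -> j != k -> exists2 X, X \in ext_chain T & rk X = j.
  move=> jr jk; have [jT|//] := ext_rank T jr.
  have := @card_missing _ M _ [:: j; k] TD; rewrite /= inE jk jT kT.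
  by move=> /(_ isT isT); rewrite -Tr addn2 ltnn.
have [A AT rA] : exists2 X, X \in ext_chain T & rk X = k.-1 by apply: other; lia.
have [C CT rC] : exists2 X, X \in ext_chain T & rk X = k.+1 by apply: other; lia.
have k0 : (0 < k)%N by lia.
have AC : A \subset C.
  by apply: (incl_cmp_rk (M := M)); rewrite ?(ext_flat AT) ?(ext_flat CT)
    ?(ext_chain_cmp TD) //; lia.
exists A, C; split=> //; first by lia.
move=> c A0; rewrite [RHS](csum_split _ (loops_sub (ext_flat AT)) AC) A0 add0r.
rewrite -(csum_cover c (ext_flat AT) (ext_flat CT) AC rA rC k0).
apply: eq_big => [F|F /andP[FT FTD]]; last first.
  rewrite (csum_split _ (loops_sub (ext_flat AT))) ?A0 ?add0r //.
  by apply: (link_below FTD AT); rewrite (link_rank TD Tr kT FT FTD); lia.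
apply/andP/and3P => [[FT FTD]|[AF FC /eqP rF]].
  have rF := link_rank TD Tr kT FT FTD.
  split; last exact/eqP.
    by apply: (link_below FTD AT); rewrite rA rF leq_pred.
  by apply: (link_above FTD CT); rewrite rC rF leqnSn.
split; first exact: (missing_notin kT).
apply: DeltaU1 => // G GT; have Gext := val_ext GT.
have := kN G GT; rewrite neq_ltn => /orP[Gk|kG].
  rewrite incl_cmpC /incl_cmp (subset_trans _ AF) //.
  apply: (incl_cmp_rk (M := M)); rewrite ?(ext_flat AT) ?proper_flatP
    ?(ext_chain_cmp TD) //.
  by rewrite rA -ltnS prednK.
rewrite /incl_cmp (subset_trans FC) //.
apply: (incl_cmp_rk (M := M)); rewrite ?(ext_flat CT) ?proper_flatP ?(ext_chain_cmp
  TD) //.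
by rewrite rC.
Qed.

Lemma modular_balanced T : T \in Delta -> #|T|.+1 = r.-1 ->
  forall l, modular l -> {in T, forall F, l F = 0} ->
  \sum_(F : proper_flat M | (F \notin T) && (F |: T \in Delta)) l F = 0.
Proof.
move=> TD Tr l [c [c0 lc]] lT.
have [k kT] := exists_missing TD ltac:(by rewrite -Tr).
have [A [C [AT CT _ sumE]]] := link_sum TD Tr kT.
rewrite (eq_bigr (fun F => csum c (val F))) => [|F _]; last exact: lc.
by rewrite sumE (csum_ext0 c0 lc lT).
Qed.

End Modular.

(** * Connectivity of links *)

Section Connectivity.
Variables (E : finType) (M : matroid E).
Implicit Types (F G H : proper_flat M) (S T : {set proper_flat M}).
Local Notation rk := (mrank M).
Local Notation r := (mrank M [set: E]).
Local Notation Delta := (order_complex M).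

(** Incomparable [F] and [G] lie in one gap of the chain. They are joined through the closures [P]
    and [Q] of one point of each over the bottom [A] of the gap, and then through the join [W] of
    [P] and [Q] if [W] is a vertex of the link. *)
Lemma link_connected (K : Type) S (phi : proper_flat M -> K) :
    S \in Delta -> (#|S|.+1 < r.-1)%N ->
    (forall F G, F \notin S -> G \notin S -> F != G -> F |: (G |: S) \in Delta ->
       phi F = phi G) ->
  forall F G, F \notin S -> F |: S \in Delta -> G \notin S -> G |: S \in Delta ->
  phi F = phi G.
Proof.
move=> SD Sr phiE.
have step F G : F \notin S -> F |: S \in Delta -> G \notin S -> G |: S \in Delta ->
    incl_cmp (val F) (val G) -> phi F = phi G.
  move=> FS FSD GS GSD FG; have [->//|FnG] := eqVneq F G.
  apply: phiE => //; apply: DeltaU1 => // H; rewrite !inE => /predU1P[->//|].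
  exact: DeltaU1_cmp FSD H.
move=> F G FS FSD GS GSD.
have [FG|FnG] := boolP (incl_cmp (val F) (val G)); first exact: step.
pose below X := (X \in ext_chain S) && (X \subset val F).
have b0 : below (loops M) by rewrite /below loops_ext loops_sub ?proper_flatP.
case: (arg_maxnP rk b0) => A /andP[AS AF] Amax.
have extF X : X \in ext_chain S -> X \subset val F \/ val F \subset X.
  by move=> XS; have /orP[] := ext_cmp (proper_flatP F) (DeltaU1_cmp FSD) XS;
    [right|left].
have extG X : X \in ext_chain S -> X \subset val G \/ val G \subset X.
  by move=> XS; have /orP[] := ext_cmp (proper_flatP G) (DeltaU1_cmp GSD) XS;
    [right|left].
(* [F] and [G] lie in the same gap of the chain S, just above [A]. *)
have belowA X : X \in ext_chain S -> X \subset val F -> X \subset A.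
  move=> XS XF; apply: (incl_cmp_rk (M := M)); rewrite ?(ext_flat XS) ?(ext_flat AS) //.
    exact: ext_chain_cmp SD _ _.
  by apply: Amax; rewrite /below XS.
have same X : X \in ext_chain S -> (X \subset val F) = (X \subset val G).
  move=> XS; apply/idP/idP => [XF|XG].
    have [//|GX] := extG X XS.
    by move: FnG; rewrite /incl_cmp (subset_trans GX XF) orbT.
  have [//|FX] := extF X XS.
  by move: FnG; rewrite /incl_cmp (subset_trans FX XG).
have AG : A \subset val G by rewrite -same.
have above X : X \in ext_chain S -> ~~ (X \subset A) ->
  val F \subset X /\ val G \subset X.
  move=> XS XA; have XF : ~~ (X \subset val F) by apply: contra XA; apply: belowA.
  have [|FX] := extF X XS; first by rewrite (negPf XF).
  by have [|GX] := extG X XS; first by rewrite -same // (negPf XF).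
have flA := ext_flat AS.
have outside H : H \notin S -> A \subset val H -> H |: S \in Delta ->
  exists2 e, e \in val H & e \notin A.
  move=> HS AH HSD; apply/subsetPn; apply: contra HS => HA.
  have HE : val H = A by apply/eqP; rewrite eqEsubset HA.
  have /ext_chainP[HA'|[HA'|[H' H'S HA']]] := AS.
  - by have := proper_flat_rk H; rewrite HE HA' rk_loops.
  - by have := proper_flat_rk H; rewrite HE HA' ltnn andbF.
  - by rewrite (_ : H = H') //; apply: val_inj; rewrite HE.
have [e eF eA] := outside F FS AF FSD.
have [e' eG' eA'] := outside G GS AG GSD.
have mid X : flat M X -> A \subset X -> ~~ (X \subset A) -> X \notin ext_chain S ->
    (forall Y, Y \in ext_chain S -> ~~ (Y \subset A) -> X \subset Y) ->
    exists H, [/\ val H = X, H \notin S & H |: S \in Delta].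
  move=> flX AX XA XS XY.
  have Xr : (0 < rk X < r)%N.
    rewrite (leq_ltn_trans (leq0n (rk A))) /=; last first.
      by apply: flat_rk_lt => //; apply: contraNneq XA => ->.
    apply: flat_rk_lt; rewrite ?subsetT //.
    by apply: contraNneq XS => ->; apply: setT_ext.
  have [H HX] := exists_proper_flat flX Xr; exists H; split=> //.
    by apply: contra XS => HS; rewrite -HX; apply: val_ext.
  apply: DeltaU1 => // Y YS; rewrite HX; have [YA|YA] := boolP (val Y \subset A).
    by rewrite /incl_cmp (subset_trans YA AX) orbT.
  by rewrite /incl_cmp XY // val_ext.
have point H x : H |: S \in Delta -> x \in val H -> x \notin A -> A \subset val H ->
    (forall Y, Y \in ext_chain S -> ~~ (Y \subset A) -> val H \subset Y) ->
    (forall Y, Y \in ext_chain S -> Y \subset val H -> Y \subset A) ->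
    exists P, [/\ val P = closure M (x |: A), P \notin S & P |: S \in Delta].
  move=> HSD xH xA AH HY YH; have sub := sub_closure M (x |: A).
  have xP : x \in closure M (x |: A) by rewrite (subsetP sub) ?inE ?eqxx.
  have PH : closure M (x |: A) \subset val H.
    by rewrite closure_min ?proper_flatP // subUset sub1set xH.
  have PA : ~~ (closure M (x |: A) \subset A) by apply: contra xA => /subsetP; apply.
  apply: mid => //; first exact: closure_flat.
  - exact: subset_trans (subsetUr _ _) sub.
  - by apply: contra PA => PS; apply: YH.
  - by move=> Y YS YA; apply: subset_trans PH _; apply: HY.
have [P [PE PS PSD]] := point F e FSD eF eA AF (fun Y YS YA =>
  (above Y YS YA).1) belowA.
have [Q [QE QS QSD]] := point G e' GSD eG' eA' AG (fun Y YS YA => (above Y YS YA).2)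
  (fun Y YS YG => belowA Y YS (etrans (same Y YS) YG)).
have PF : phi P = phi F.
  apply: step => //; rewrite /incl_cmp PE closure_min ?proper_flatP //.
  by rewrite subUset sub1set eF.
have QG : phi Q = phi G.
  apply: step => //; rewrite /incl_cmp QE closure_min ?proper_flatP //.
  by rewrite subUset sub1set eG'.
pose W := closure M (e |: (e' |: A)).
have subW := sub_closure M (e |: (e' |: A)).
have AW : A \subset W.
  by apply: subset_trans subW; apply: subset_trans (subsetUr _ _) (subsetUr _ _).
have eW : e \in W by rewrite (subsetP subW) ?inE ?eqxx.
have WA : ~~ (W \subset A) by apply: contra eA => /subsetP; apply.
have [WS|WS] := boolP (W \in ext_chain S); last first.
  have [|H [HE HS HSD]] := mid W (closure_flat _ _) AW WA WS.
    move=> Y YS YA; have [FY GY] := above Y YS YA.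
    apply: closure_min; first exact: ext_flat YS.
    by rewrite !subUset !sub1set (subsetP FY) // (subsetP GY) //= (subset_trans AF).
  rewrite -PF -QG; transitivity (phi H); [apply: step|apply: esym; apply: step] => //.
    rewrite /incl_cmp PE HE closure_min ?closure_flat //.
    by rewrite subUset AW sub1set eW.
  rewrite /incl_cmp QE HE closure_min ?closure_flat //.
  by rewrite subUset AW sub1set (subsetP subW) // !inE eqxx orbT.
(* Here [W] is the top of the gap, so [F] has rank one more than [A]. A neighbour [H] of [F], which
   exists by codimension, then lies below [A] or above [W] and is comparable with [G] too. *)
have [FW GW] := above W WS WA.
have [H HFS HFSD] := Delta_pure FSD ltac:(by rewrite cardsU1 FS add1n).
have [HF HS] : H != F /\ H \notin S by apply/andP; rewrite -negb_or -in_setU1.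
have HSD : H |: S \in Delta by apply: Delta_down HFSD; rewrite setUS ?subsetUr.
have cHF := DeltaU1_cmp HFSD (setU11 F S).
transitivity (phi H); first by apply: step => //; rewrite incl_cmpC.
apply: step => //.
have rkW : (rk W <= (rk A).+2)%N.
  rewrite rk_closure; apply: leq_trans (rk_add M _ e) _.
  by rewrite ltnS rk_add.
have rkF : (rk (val F) = (rk A).+1)%N.
  have FnW : val F != W.
    apply: contraNneq FS => FW'; have /ext_chainP[WE|[WE|[F' F'S WE]]] := WS.
    - by have := proper_flat_rk F; rewrite FW' WE rk_loops.
    - by have := proper_flat_rk F; rewrite FW' WE ltnn andbF.
    - by rewrite (_ : F = F') //; apply: val_inj; rewrite FW' WE.
  apply/eqP; rewrite eqn_leq -ltnS (leq_trans (flat_rk_lt _ FW FnW) rkW)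
    ?proper_flatP //.
  by apply: flat_rk_lt => //; apply: contraTneq eF => <-.
have HFval : val H != val F by rewrite (inj_eq val_inj).
case/orP: cHF => [HsubF|FsubH].
  rewrite /incl_cmp (subset_trans _ AG) //; apply: (link_above HSD AS).
  by rewrite -ltnS -rkF; apply: flat_rk_lt; rewrite ?proper_flatP.
rewrite /incl_cmp (subset_trans GW) ?orbT //; apply: (link_below HSD WS).
apply: leq_trans rkW _; rewrite -rkF.
by apply: flat_rk_lt; rewrite ?proper_flatP // eq_sym.
Qed.

End Connectivity.

(** * Quadrics of codimension-two faces *)

Section Quadrics.
Variables (R : realType) (E : finType) (M : matroid E).
Local Notation rk := (mrank M).
Local Notation r := (mrank M [set: E]).
Local Notation Delta := (order_complex M).
Local Notation modular := (@modular_vector R E M).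
Implicit Types (F G : proper_flat M) (S T : {set proper_flat M}).
Variable f : {polyOn R, proper_flat M}.
Hypothesis f_complex : complex_of f = Delta.
Hypothesis f_modular : forall l, modular l -> lineality f l.
Hypothesis f_facet : forall S, S \in Delta -> #|S| = r.-1 -> dset S f = 1.

Lemma dset_lineality l S : modular l -> ddir l (dset S f) = 0.
Proof. by move=> /f_modular fl; rewrite ddir_dset (fl : ddir l f = 0) dset_set0. Qed.

Lemma dset_out S : S \notin Delta -> dset S f = 0.
Proof. by rewrite -f_complex inE negbK => /eqP. Qed.

Lemma missing_link S F : F \notin S -> F |: S \in Delta -> missing S (rk (val F)).
Proof.
move=> FS FSD; rewrite /missing proper_flat_rk /=; apply/forall_inP => G GS.
apply: contraNneq FS => GF; rewrite (_ : F = G) //.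
by apply: (Delta_rk_inj FSD); rewrite ?inE ?eqxx ?GS ?orbT.
Qed.

Lemma missingU1 S k F : missing S k -> rk (val F) != k -> missing (F |: S) k.
Proof.
move=> /andP[kr /forall_inP kS] Fk; rewrite /missing kr /=.
by apply/forall_inP => G; rewrite !inE => /predU1P[->//|]; apply: kS.
Qed.

Section CodimensionTwo.
Variables (S : {set proper_flat M}) (k : nat).
Hypothesis SD : S \in Delta.
Hypothesis S_card : (#|S| + 2)%N = r.-1.
Hypothesis k_missing : missing S k.
Hypothesis k_min : forall j, missing S j -> (k <= j)%N.

(** A modular vector equal to the indicator of [F] on [T] turns the entry into minus the sum over
    the neighbours of [T], hence into minus the value at the upper end [C] of the gap, which is 0 or
    1. Minimality of [k] ensures that the lower end [A] is not [F], so the value there is 0. *)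
Lemma hess_diag F : F \notin S -> rk (val F) != k -> hess (dset S f) F F <= 0.
Proof.
move=> FS Fk; rewrite /hess -dsetU1 //.
have [TD|/dset_out ->] := boolP (F |: S \in Delta); last by rewrite linear0 mcoeff0.
set T := F |: S in TD *; have kT : missing T k by apply: missingU1.
have Tr : #|T|.+1 = r.-1 by rewrite cardsU1 FS -S_card addn2.
have FT : F \in T by rewrite setU11.
have [l [[c [c0 lc]] lT]] := modular_hereditary TD [ffun G => (G == F)%:R : R].
have {}lT : {in T, forall G, l G = (G == F)%:R} by move=> G GT; rewrite lT // ffunE.
have lmod : modular l by exists c.
have {}lc G : l G = csum M c (val G) by exact: lc.
rewrite (mderiv_of_ddir FT lT (dset_lineality T lmod)) mcoeffN oppr_le0 raddf_sum /=.
have -> : \sum_(G | G \notin T) (l G *: 'd_G (dset T f))@_0%MM =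
    \sum_(G | (G \notin T) && (G |: T \in Delta)) csum M c (val G).
  rewrite big_mkcondr; apply: eq_bigr => G GT; rewrite -dsetU1 // mcoeffZ lc.
  case: ifP => [GTD|/negbT/dset_out ->]; last by rewrite mcoeff0 mulr0.
  by rewrite f_facet ?mcoeff1 ?eqxx ?mulr1 // cardsU1 GT -Tr.
have [A [C [AT CT Ak ->]]] := link_sum R TD Tr kT.
  case/ext_chainP: CT => [->|[->|[G GT ->]]].
  - by rewrite csum_loops.
  - by rewrite csum_setT c0.
  - by rewrite -lc lT // ler0n.
case/ext_chainP: AT Ak => [->|[->|[G GT ->]]] Ak.
- by rewrite csum_loops.
- by rewrite csum_setT c0.
rewrite -lc lT //; case: eqP => // GF; move: Ak.
by rewrite GF ltnNge k_min // missing_link.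
Qed.

(** Two adjacent neighbours of [S] must fill both of its free ranks, so one of them has rank [k]. *)
Lemma hess_offdiag F G : F != G -> F \notin S -> G \notin S ->
    ~~ ((F |: S \in Delta) && (rk (val F) == k)) ->
    ~~ ((G |: S \in Delta) && (rk (val G) == k)) ->
  hess (dset S f) F G = 0.
Proof.
move=> FG FS GS Fk Gk; have FGS : F \notin G |: S by rewrite !inE negb_or FG.
rewrite /hess -!dsetU1 //.
have [FGD|/dset_out ->] := boolP (F |: (G |: S) \in Delta); last by rewrite mcoeff0.
have FD : F |: S \in Delta by apply: Delta_down FGD; rewrite setUS ?subsetUr.
have GD : G |: S \in Delta by apply: Delta_down FGD; rewrite subsetUr.
rewrite FD /= in Fk; rewrite GD /= in Gk.
have := @card_missing _ M _ [:: k] FGD isT.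
rewrite /= (missingU1 (missingU1 k_missing Gk) Fk) => /(_ isT).
by rewrite !cardsU1 FGS GS /= -S_card !add1n addn1 addn2 ltnn.
Qed.

(** Modulo modular vectors, a vector of the hyperplane can be made zero on [S] and on the set [P] of
    neighbours of rank [k]. What remains meets only the nonpositive diagonal entries and the zero
    off-diagonal ones. *)
Lemma quadric_hyperplane : exists c : proper_flat M -> R,
  forall x : {ffun proper_flat M -> R}, \sum_F c F * x F = 0 ->
    polar (dset S f) [:: x; x] <= 0.
Proof.
have /andP[/andP[k0 kr] kN] := k_missing.
pose P := [set F | [&& F \notin S, F |: S \in Delta & rk (val F) == k]].
(* The rank k - 1 is occupied, since [k] is the least free rank. *)
have [A AS rA] : exists2 A, A \in ext_chain S & rk A = k.-1.
  have [km|//] := ext_rank S (k := k.-1) (leq_trans (leq_pred k) (ltnW kr)).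
  by have := k_min km; rewrite leqNgt ltn_predL k0.
have flA := ext_flat AS; have lA := loops_sub flA.
have [e0 _] : exists e0, e0 \in [set: E].
  have [E0|[e0]] := set_0Vmem [set: E]; last by exists e0.
  by move: S_card; rewrite E0 rk_set0 addn2.
have [e eP] : exists e : proper_flat M -> E,
    forall F, F \in P -> e F \in val F /\ e F \notin A.
  apply: (@fin_all_exists _ _ (fun F e => F \in P -> e \in val F /\ e \notin A)).
  move=> F; have [|FP] := boolP (F \in P); last by exists e0.
  rewrite inE => /and3P[FS FSD /eqP Fk].
  have /properP[_ [e1 e1F e1A]] : A \proper val F.
    rewrite properE (link_below FSD AS) ?rA ?Fk ?leq_pred //.
    by apply/negP => /(rk_mono M); rewrite rA Fk leqNgt ltn_predL k0.
  by exists e1.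
have [lv lvP] := fin_all_exists (fun G : proper_flat M =>
  modular_hereditary (R := R) SD [ffun F => (F == G)%:R]).
(* This functional is the sum over [P] of the vector [x1], obtained from [x] by clearing its
   coordinates in [S]. *)
exists (fun F => (F \in P)%:R - (F \in S)%:R * \sum_(G in P) lv F G) => x cx.
pose x1 : {ffun proper_flat M -> R} := x - \sum_(G in S) [ffun F => x G * lv G F].
have x1E F : x1 F = x F - \sum_(G in S) x G * lv G F.
  by rewrite !ffunE sum_ffunE; congr (_ - _); apply: eq_bigr => G _; rewrite ffunE.
have x1S F : F \in S -> x1 F = 0.
  move=> FS; rewrite x1E (bigD1 F) //= big1 ?addr0.
    by rewrite (lvP F).2 // ffunE eqxx mulr1 subrr.
  move=> G /andP[GS GF]; rewrite (lvP G).2 // ffunE eq_sym (negPf GF).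
  by rewrite mulr0.
have x1P : \sum_(F in P) x1 F = 0.
  rewrite -[RHS]cx (eq_bigr _ (fun F _ => x1E F)) sumrB exchange_big /=.
  rewrite big_mkcond [X in _ - X]big_mkcond -sumrB; apply: eq_bigr => F _.
  by case: (F \in P); case: (F \in S); rewrite -?mulr_sumr /=; ring.
(* The mass [x1 F] is placed at a point of [F] outside [A]. Distinct flats of [P] meet in [A], so
   the modular vector [l] agrees with [x1] on [P]. On [S] it vanishes: flats below [A] contain no
   mass, and those above contain the total, which is 0. *)
pose c i := \sum_(F in P) (i == e F)%:R * x1 F.
have sumc (X : {set E}) : \sum_(i in X) c i = \sum_(F in P) (e F \in X)%:R * x1 F.
  by rewrite exchange_big; apply: eq_bigr => F _; rewrite sum_delta.
have el F : F \in P -> e F \notin loops M.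
  by move=> /eP[_ eA]; apply: contra eA; apply: (subsetP lA).
pose l : {ffun proper_flat M -> R} := [ffun F => csum M c (val F)].
have lmod : modular l.
  exists c; split=> [|F]; last by rewrite ffunE.
  rewrite sumc -[RHS]x1P; apply: eq_bigr => F FP.
  by rewrite in_setC el // mul1r.
have lE F : l F = \sum_(G in P) (e G \in val F)%:R * x1 G.
  rewrite ffunE /csum sumc; apply: eq_bigr => G GP.
  by rewrite in_setD el.
have lS F : F \in S -> l F = 0.
  move=> FS; have := val_ext FS => Fext; rewrite lE.
  have := forall_inP kN F FS; rewrite neq_ltn => /orP[Fk|kF].
    have FA : val F \subset A.
      apply: (incl_cmp_rk (M := M)); rewrite ?proper_flatP ?(ext_chain_cmp SD) //.
      by rewrite rA -ltnS prednK.
    rewrite big1 // => G /eP[_ eA]; rewrite (_ : _ \in _ = false) ?mul0r //.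
    by apply: contraNF eA; apply: (subsetP FA).
  rewrite -[RHS]x1P; apply: eq_bigr => G GP; have [eG _] := eP G GP.
  move: GP; rewrite inE => /and3P[GS GSD /eqP Gk].
  by rewrite (subsetP (link_above GSD Fext _) _ eG) ?mul1r // Gk ltnW.
have lP F : F \in P -> l F = x1 F.
  move=> FP; rewrite lE (bigD1 F) //= (eP F FP).1 mul1r big1 ?addr0 //.
  move=> G /andP[GP GF]; rewrite (_ : _ \in _ = false) ?mul0r //.
  apply: contraNF GF => eF; have [eG eA] := eP G GP.
  move: FP; rewrite in_set => /and3P[FS FSD /eqP Fk].
  move: GP; rewrite in_set => /and3P[GS GSD /eqP Gk].
  have cl H : H |: S \in Delta -> rk (val H) = k -> e G \in val H ->
      val H = closure M (e G |: A).
    move=> HSD Hk eH; symmetry; apply: (flat_eq (M := M)); first exact: closure_flat.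
      apply: closure_min; first exact: proper_flatP.
      by rewrite subUset sub1set eH (link_below HSD AS) // rA Hk leq_pred.
    by rewrite rk_cover // rA Hk prednK.
  apply/eqP/val_inj; exact: etrans (cl G GSD Gk eG) (esym (cl F FSD Fk eF)).
pose x2 := x1 - l.
have x2E F : x2 F = x1 F - l F by rewrite ffunE [(- l) F]ffunE.
have x2S F : F \in S -> x2 F = 0 by move=> FS; rewrite x2E x1S ?lS ?subrr.
have x2P F : F \in P -> x2 F = 0 by move=> FP; rewrite x2E lP ?subrr.
have xmod : modular (x - x2).
  have -> : x - x2 = \sum_(G in S) [ffun F => x G * lv G F] + l.
    by rewrite /x2 /x1 !opprB addrC addrA subrK addrC.
  apply: modular_add => //; apply: (big_ind modular).
  - exact: modular0.
  - exact: modular_add.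
  - by move=> G GS; apply: modular_scale; have [] := lvP G.
have hx y : polar (dset S f) (x :: y) = polar (dset S f) (x2 :: y).
  rewrite -[x](subrK x2) addrC; apply: polar_lineality; exact: dset_lineality.
rewrite hx polarC hx -(bform_polar _ x2 x2 [::]) /=.
apply: sumr_le0 => F _; rewrite (bigD1 F) //= big1 => [|G GF].
  have [xF0|xF0] := eqVneq (x2 F) 0; first by rewrite xF0 mulr0 mulr0 addr0.
  rewrite addr0 -expr2; apply: mulr_le0_ge0; last exact: sqr_ge0.
  have FS : F \notin S by apply: contra_neqN xF0 => /x2S.
  have [FSD|FSD] := boolP (F |: S \in Delta).
    apply: hess_diag => //; apply: contraNneq xF0 => Fk; apply/eqP.
    by apply: x2P; rewrite inE FS FSD Fk eqxx.
  by rewrite /hess -dsetU1 // dset_out // linear0 mcoeff0.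
have [xF0|xF0] := eqVneq (x2 F) 0; first by rewrite xF0 mul0r mulr0.
have [xG0|xG0] := eqVneq (x2 G) 0; first by rewrite xG0 mulr0 mulr0.
have FS : F \notin S by apply: contra_neqN xF0 => /x2S.
have GS : G \notin S by apply: contra_neqN xG0 => /x2S.
have notP H : H \notin S -> x2 H != 0 -> ~~ ((H |: S \in Delta) && (rk (val H) == k)).
  by move=> HS; apply: contra_neqN => HP; apply: x2P; rewrite in_set HS.
by rewrite hess_offdiag ?mul0r ?notP // eq_sym.
Qed.

End CodimensionTwo.

End Quadrics.

(** * Facets of the order complex and conclusion *)

Lemma order_complex_facets (E : finType) (M : matroid E) (S : {set proper_flat M}) :
  (S \in facets (order_complex M)) =
  (S \in order_complex M) && (#|S| == (mrank M [set: E]).-1).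
Proof.
rewrite inE; apply/maxsetP/andP => [[SD Smax]|[SD /eqP Sr]]; split=> //.
  rewrite eqn_leq card_Delta // leqNgt; apply/negP => Sr.
  have [F FS FSD] := Delta_pure SD Sr.
  by move: FS; rewrite -(Smax _ FSD (subsetUr _ _)) setU11.
move=> T TD ST; apply/eqP; rewrite eq_sym eqEcard ST Sr.
exact: card_Delta.
Qed.

Theorem theorem4p3 (R : realType) (E : finType) (M : matroid E)
    (hr : (2 <= mrank M [set: E])%N) :
  exists vol : {polyOn R, proper_flat M},
    unique (@is_vol R E M) vol /\ hereditary_Lorentzian vol.
Proof.
have her := @modular_hereditary R E M.
have [f [fd fD fL f1]] := existence_of_vol (@Delta_down E M) (@modular_sub R E M)
  (@modular_scale R E M) her (Delta_set0 M) (@card_Delta E M) (@Delta_pure E M)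
  (@modular_balanced R E M).
have fher : strongly_hereditary f.
  move=> S; rewrite fD => SD a; have [l [lm lS]] := her S SD a.
  by exists l; split=> //; apply: fL.
exists f; split.
  split.
    split=> // S; rewrite order_complex_facets => /andP[SD /eqP]; exact: f1.
  move=> g [gd _ gD gL g1].
  apply: (uniqueness_of_vol her (Delta_set0 M) fd gd fD gD fL gL) => S SD Sr.
  by rewrite f1 // g1 // order_complex_facets SD Sr eqxx.
apply: (@locally_Lorentzian_hereditary _ _ (mrank M [set: E]).-1).
  move=> S; rewrite fD in_setD order_complex_facets => /andP[+ SD].
  by rewrite SD /= ltn_neqAle card_Delta // andbT.
split=> // [||S|S].
- by have := Delta_set0 M; rewrite -fD inE dset0.
- by move=> F; rewrite fD; apply/DeltaP => G H; rewrite !inE => /eqP -> /eqP ->;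
  apply: incl_cmpxx.
- rewrite fD => SD Sr phi phiE; apply: link_connected => //; lia.
rewrite fD => SD Sr.
(* A face of codimension two has free ranks; the least one is chosen because the sign in [hess_diag]
   depends on it. *)
have ex_k : exists k, missing S k by apply: exists_missing => //; rewrite -Sr addn2.
case: (ex_minnP ex_k) => k kS kmin.
exact: (quadric_hyperplane fD fL f1 SD Sr kS kmin).
Qed.
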